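(* Let $\Lambda$ be an acyclic Nakayama algebra. Then $\operatorname{mod}\Lambda$ admits an $n\mathbb{Z}$-cluster tilting subcategory $\mathcal{C}_\Lambda$ if and only if $\Lambda=\Lambda_1\ast\cdots\ast\Lambda_r$ for some homogeneous acyclic Nakayama algebras $\Lambda_1,\dots,\Lambda_r$ each of which admits an $n\mathbb{Z}$-cluster tilting subcategory $\mathcal{C}_{\Lambda_k}$. In this case $\mathcal{C}_\Lambda=\operatorname{add}\{\mathcal{C}_{\Lambda_k}\mid 1\le k\le r\}$ (regarding $\Lambda_k$-modules as $\Lambda$-modules).
   Context: $\mathbf{k}$ is a field, $n\ge2$. For integers $a<b$, $A_{[a,b]}$ is the quiver with vertices $a,\dots,b$ and arrows $\alpha_i\colon i\to i-1$ for $a<i\le b$. An acyclic Nakayama algebra is $\mathbf{k}A_{[a,b]}/I$ with $I$ an admissible ideal (between $R^N$ and $R^2$, $R$ the arrow ideal); it is homogeneous if $I=R^l$ for some $l\ge2$. Gluing: for $m_1<m_2<m_3$ and acyclic Nakayama algebras $\Lambda_1=\mathbf{k}A_{[m_1,m_2]}/I_1$, $\Lambda_2=\mathbf{k}A_{[m_2,m_3]}/I_2$, define $\Lambda_1\ast\Lambda_2=\mathbf{k}A_{[m_1,m_3]}/I$ where $I$ is generated by $I_1\cup I_2\cup\{\alpha_{m_2}\alpha_{m_2+1}\}$ (the path $m_2+1\to m_2\to m_2-1$). This operation is associative; $\Lambda_1$ and $\Lambda_2$ are quotients of $\Lambda_1\ast\Lambda_2$, so their modules are naturally $\Lambda_1\ast\Lambda_2$-modules.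 For a finite-dimensional algebra $\Lambda$, $\mathcal{C}\subseteq\operatorname{mod}\Lambda$ (finitely generated left modules) is $n$-cluster tilting if functorially finite and $\mathcal{C}=\{X\mid \operatorname{Ext}^i(\mathcal{C},X)=0,\ 0<i<n\}=\{X\mid\operatorname{Ext}^i(X,\mathcal{C})=0,\ 0<i<n\}$; $n\mathbb{Z}$-cluster tilting if moreover $\operatorname{Ext}^i(\mathcal{C},\mathcal{C})\ne0$ implies $i\in n\mathbb{Z}$. *)

(* Defs.v *)
From Stdlib Require List.
From HB Require Import structures.
From mathcomp Require Import all_boot all_order all_algebra.
Set Implicit Arguments. Unset Strict Implicit. Unset Printing Implicit Defensive.
Import Order.TTheory GRing.Theory Num.Theory.
Local Open Scope ring_scope.

(* A path in A_[a,b] is given by its start vertex j and its length l; it ends at j - l. *)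
Definition valid_path (a b : int) (j : int) (l : nat) : bool :=
  (a <= j - l%:Z) && (j <= b).

(* An acyclic Nakayama algebra kA_[a,b]/I.  Since between two vertices of A_[a,b]
   there is at most one path, every ideal I of the path algebra is spanned by the
   paths it contains; we record I by this set of paths  na_z j l  (path from j of
   length l lies in I).  Admissibility: I is an ideal (closed under extending paths),
   I contains no path of length 0 or 1 (I <= R^2); R^N <= I is automatic for
   N = b - a + 1 since R^N = 0.  Junk values outside valid paths are fixed to false. *)
Record nakalg := NakAlg {
  na_a : int;
  na_b : int;
  na_ab : na_a < na_b;
  na_z : int -> nat -> bool;
  na_canon : forall j l, ~~ valid_path na_a na_b j l -> ~~ na_z j l;
  na_ideal : forall j l j' l', valid_path na_a na_b j' l' ->
     j <= j' -> j' - l'%:Z <= j - l%:Z -> na_z j l -> na_z j' l';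
  na_adm : forall j, ~~ na_z j 0 /\ ~~ na_z j 1
}.

Definition nak_eq (L L' : nakalg) : Prop :=
  na_a L = na_a L' /\ na_b L = na_b L' /\ forall j l, na_z L j l = na_z L' j l.

(* homogeneous: I = R^l for some l >= 2 *)
Definition homogeneous (L : nakalg) : Prop :=
  exists l : nat, (2 <= l)%N /\
    forall j l', valid_path (na_a L) (na_b L) j l' -> na_z L j l' = (l <= l')%N.

(* L is the gluing L1 * L2: ideal generated by I1, I2 and the path
   m2+1 -> m2 -> m2-1 (m2 = end of L1 = start of L2). *)
Definition is_glue (L1 L2 L : nakalg) : Prop :=
  na_b L1 = na_a L2 /\ na_a L = na_a L1 /\ na_b L = na_b L2 /\
  forall j l, valid_path (na_a L) (na_b L) j l ->
    (na_z L j l <->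
      ((exists j' l', j' <= j /\ j - l%:Z <= j' - l'%:Z /\ (na_z L1 j' l' \/ na_z L2 j' l'))
       \/ (na_b L1 + 1 <= j /\ j - l%:Z <= na_b L1 - 1))).

Fixpoint glued (Ls : seq nakalg) (L : nakalg) : Prop :=
  match Ls with
  | [::] => False
  | L1 :: Ls' =>
      match Ls' with
      | [::] => nak_eq L1 L
      | _ => exists L', glued Ls' L' /\ is_glue L1 L' L
      end
  end.

Section Modules.
Variable k : fieldType.

(* A finite-dimensional representation: total space k^dim (row vectors),
   vertex idempotents e_i and arrow maps alpha_i (acting on the right). *)
Record rep := Rep {
  rdim : nat;
  ridem : int -> 'M[k]_rdim;
  rarr : int -> 'M[k]_rdim
}.

Fixpoint pathm (X : rep) (j : int) (l : nat) : 'M[k]_(rdim X) :=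
  match l with
  | 0%N => ridem X j
  | l'.+1 => rarr X j *m pathm X (j - 1) l'
  end.

Definition is_module (L : nakalg) (X : rep) : Prop :=
  (forall i, ridem X i *m ridem X i = ridem X i) /\
  (forall i j, i != j -> ridem X i *m ridem X j = 0) /\
  (forall i, (i < na_a L) || (na_b L < i) -> ridem X i = 0) /\
  (\sum_(l < `|na_b L - na_a L|%N.+1) ridem X (na_a L + l%:Z) = 1%:M) /\
  (forall i, rarr X i = ridem X i *m rarr X i *m ridem X (i - 1)) /\
  (forall j l, na_z L j l -> pathm X j l = 0).

Definition Hom (X Y : rep) (f : 'M[k]_(rdim X, rdim Y)) : Prop :=
  forall i, ridem X i *m f = f *m ridem Y i /\ rarr X i *m f = f *m rarr Y i.

Definition ses (Y E X : rep) (f : 'M[k]_(rdim Y, rdim E)) (g : 'M[k]_(rdim E, rdim X)) : Prop :=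
  Hom f /\ Hom g /\ row_free f /\ row_full g /\ (f == kermx g)%MS.

Definition projective (L : nakalg) (P : rep) : Prop :=
  is_module L P /\
  forall (M N : rep) (g : 'M[k]_(rdim M, rdim N)) (h : 'M[k]_(rdim P, rdim N)),
    is_module L M -> is_module L N -> Hom g -> row_full g -> Hom h ->
    exists h' : 'M[k]_(rdim P, rdim M), Hom h' /\ h' *m g = h.

(* ext0 L i X Y  <->  Ext^(i+1)_L(X, Y) = 0.
   Ext^1 = 0 iff every extension splits; Ext^(i+2)(X,Y) = Ext^(i+1)(K,Y) for a
   short exact sequence 0 -> K -> P -> X -> 0 with P projective. *)
Fixpoint ext0 (L : nakalg) (i : nat) (X Y : rep) : Prop :=
  match i with
  | 0%N => forall (E : rep) f g, is_module L E -> @ses Y E X f g ->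
            exists s : 'M[k]_(rdim X, rdim E), Hom s /\ s *m g = 1%:M
  | i'.+1 => exists (K P : rep) f g,
            is_module L K /\ projective L P /\ @ses K P X f g /\ ext0 L i' K Y
  end.

(* Ext^i_L(X,Y) = 0, for i >= 1 *)
Definition Ext_vanish (L : nakalg) (i : nat) (X Y : rep) : Prop := ext0 L i.-1 X Y.

Definition subcat (L : nakalg) (C : rep -> Prop) : Prop :=
  forall X, C X -> is_module L X.

Definition contrav_finite (L : nakalg) (C : rep -> Prop) : Prop :=
  forall X, is_module L X ->
    exists (Z : rep) (f : 'M[k]_(rdim Z, rdim X)), C Z /\ Hom f /\
      forall (Z' : rep) (h : 'M[k]_(rdim Z', rdim X)), C Z' -> Hom h ->
        exists h' : 'M[k]_(rdim Z', rdim Z), Hom h' /\ h' *m f = h.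

Definition cov_finite (L : nakalg) (C : rep -> Prop) : Prop :=
  forall X, is_module L X ->
    exists (Z : rep) (f : 'M[k]_(rdim X, rdim Z)), C Z /\ Hom f /\
      forall (Z' : rep) (h : 'M[k]_(rdim X, rdim Z')), C Z' -> Hom h ->
        exists h' : 'M[k]_(rdim Z, rdim Z'), Hom h' /\ f *m h' = h.

Definition funct_finite (L : nakalg) (C : rep -> Prop) : Prop :=
  contrav_finite L C /\ cov_finite L C.

Definition n_cluster_tilting (n : nat) (L : nakalg) (C : rep -> Prop) : Prop :=
  subcat L C /\ funct_finite L C /\
  (forall X, is_module L X ->
     (C X <-> forall i, (0 < i < n)%N -> forall Z, C Z -> Ext_vanish L i Z X)) /\
  (forall X, is_module L X ->
     (C X <-> forall i, (0 < i < n)%N -> forall Z, C Z -> Ext_vanish L i X Z)).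

Definition nZ_cluster_tilting (n : nat) (L : nakalg) (C : rep -> Prop) : Prop :=
  n_cluster_tilting n L C /\
  forall i, (0 < i)%N -> forall Z W, C Z -> C W -> ~ Ext_vanish L i Z W -> (n %| i)%N.

Definition zero_rep : rep := @Rep 0%N (fun _ => 0) (fun _ => 0).

Definition dsum (X Y : rep) : rep :=
  @Rep (rdim X + rdim Y)%N
    (fun i => block_mx (ridem X i) 0 0 (ridem Y i))
    (fun i => block_mx (rarr X i) 0 0 (rarr Y i)).

Definition dsum_list (Ys : seq rep) : rep := foldr dsum zero_rep Ys.

Definition add_of (L : nakalg) (S : rep -> Prop) (X : rep) : Prop :=
  is_module L X /\
  exists Ys : seq rep, (forall Y, List.In Y Ys -> S Y) /\
    exists (s : 'M[k]_(rdim X, rdim (dsum_list Ys))) (p : 'M[k]_(rdim (dsum_list Ys), rdim X)),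
      Hom s /\ Hom p /\ s *m p = 1%:M.

End Modules.

(* Main.v *)
(* Every module over an acyclic Nakayama algebra is a direct sum of uniserial interval
   modules ]u, v] with composition factors S_w, u < w <= v; the algebra is encoded by the function
   g on [A, B] = [a - 1, b] for which the projective cover of ]u, v] is ]g v, v], so that the
   syzygy is ]g v, u]. Hence Ext^1(]u, v], ]u', v']) is nonzero exactly when
   g v <= u' < u <= v' < v, and nZ-cluster tilting becomes a condition on sets c of pairs (u, v).
   Nonvanishing Ext strictly decreases both ends, which makes c unique by induction.
   The crux is that c is closed under ]u, v] |-> Omega tau^- ]u, v] = ]g (v + 1), u + 1] on
   noninjective intervals, and dually. Where g jumps by at least 2, or repeats a value that is not
   the minimal one, this closure puts a simple module S_x in c with x not an end point; and any such
   x is a gluing vertex, i.e. g (x + 1) = x - 1. So if c contains no such simple module, g is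
   v |-> max(A, v - l) and the algebra is homogeneous; otherwise one cuts at the least such x. *)
From Stdlib Require List.
From Stdlib Require Import Classical.
From mathcomp Require Import all_boot all_order all_algebra zify.
Require Import Defs.
Set Implicit Arguments. Unset Strict Implicit. Unset Printing Implicit Defensive.
Import Order.TTheory GRing.Theory Num.Theory.

(** The closure under Omega tau^- is where the nZ condition enters. For noninjective X in the set,
    tau^- Omega^-(n-1) X is again in the set by Auslander-Reiten duality; its n-th syzygy is Omega
    tau^- X, and since Ext within the set lives in degrees divisible by n, this syzygy passes the
    Ext test of the set too. Half-open intervals keep the operators free of offsets: Omega ]u, v] =
    ]g v, u], Omega^- ]u, v] = ]v, f u] with [f] adjoint to [g], and tau^- ]u, v] = ]u + 1, v + 1].
    Negating vertices exchanges [f] and [g] and yields the dual statements. Gluing and cutting rest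
    on one fact: a nonzero Ext from above the cut vertex x to below it factors through S_x, and the
    two degrees add, so multiples of n stay multiples of n. On the module side the obstacle is that
    [ext0] chooses its projective presentation existentially; independence of the choice is proved
    through retracts up to maps that factor through projectives. *)

Section Homomorphisms.
Local Open Scope ring_scope.
Variable k : fieldType.
Implicit Types X Y Z E K P Q M N : rep k.

(** * Linear algebra of representations: exact sequences, retracts, direct sums *)

Lemma hom0 X Y : @Hom k X Y 0.
Proof. by move=> i; rewrite !mulmx0 !mul0mx. Qed.

Lemma hom1 X : @Hom k X X 1%:M.
Proof. by move=> i; rewrite !mulmx1 !mul1mx. Qed.

Lemma homM X Y Z f g : @Hom k X Y f -> @Hom k Y Z g -> @Hom k X Z (f *m g).
Proof.
move=> hf hg i; case: (hf i) (hg i) => a b [c d].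
by rewrite !mulmxA a b -!mulmxA c d.
Qed.

Lemma homD X Y f g : @Hom k X Y f -> @Hom k X Y g -> @Hom k X Y (f + g).
Proof.
by move=> hf hg i; case: (hf i) (hg i) => a b [c d]; rewrite !mulmxDl !mulmxDr a b c d.
Qed.

Lemma homN X Y f : @Hom k X Y f -> @Hom k X Y (- f).
Proof. by move=> hf i; case: (hf i) => a b; rewrite !mulmxN !mulNmx a b. Qed.

Lemma homZ X Y a f : @Hom k X Y f -> @Hom k X Y (a *: f).
Proof. by move=> hf i; case: (hf i) => b c; rewrite -!scalemxAl -!scalemxAr b c. Qed.

Lemma homB X Y f g : @Hom k X Y f -> @Hom k X Y g -> @Hom k X Y (f - g).
Proof. by move=> hf hg; apply: homD => //; apply: homN. Qed.

Lemma hom_pathm X Y f j l : @Hom k X Y f -> pathm X j l *m f = f *m pathm Y j l.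
Proof.
move=> hf; elim: l j => [|l IH] j /=; first by case: (hf j).
by rewrite -mulmxA IH mulmxA; case: (hf j) => _ ->; rewrite -mulmxA.
Qed.

Lemma full_cancel (m n p : nat) (g : 'M[k]_(m, n)) (a b : 'M[k]_(n, p)) :
  row_full g -> g *m a = g *m b -> a = b.
Proof.
by move=> /row_fullP [g' Hg] H; rewrite -[a]mul1mx -[b]mul1mx -Hg -!mulmxA H.
Qed.

Lemma free_cancel (m n p : nat) (f : 'M[k]_(m, n)) (a b : 'M[k]_(p, m)) :
  row_free f -> a *m f = b *m f -> a = b.
Proof.
by move=> /row_freeP [f' Hf] H; rewrite -[a]mulmx1 -[b]mulmx1 -Hf !mulmxA H.
Qed.

Lemma hom_epi_factor X Y Z g t :
  @Hom k X Y g -> row_full g -> @Hom k X Z (g *m t) -> @Hom k Y Z t.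
Proof.
move=> hg fg hgt i; case: (hg i) (hgt i) => a b [c d].
by split; apply: (full_cancel fg); rewrite mulmxA -?a -?b -mulmxA ?c ?d mulmxA.
Qed.

Lemma hom_mono_factor X Y Z f t :
  @Hom k Y Z f -> row_free f -> @Hom k X Z (t *m f) -> @Hom k X Y t.
Proof.
move=> hf ff htf i; case: (hf i) (htf i) => a b [c d].
by split; apply: (free_cancel ff); rewrite -!mulmxA ?a ?b ?c ?d -mulmxA.
Qed.

(** Each defining relation is an equation between endomorphisms, so it can be checked after
    composing with [g] and cancelling. Retracts and pushouts become modules this way. *)
Lemma module_epi L X Y g : is_module L X -> @Hom k X Y g -> row_full g -> is_module L Y.
Proof.
move=> [i1 [i2 [i3 [i4 [i5 i6]]]]] hg fg.
have eg i : g *m ridem Y i = ridem X i *m g by case: (hg i).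
have ag i : g *m rarr Y i = rarr X i *m g by case: (hg i).
split; [|split; [|split; [|split; [|split]]]].
- by move=> i; apply: (full_cancel fg); rewrite mulmxA !eg -mulmxA eg mulmxA i1.
- by move=> i j ij; apply: (full_cancel fg); rewrite mulmxA !eg -mulmxA eg mulmxA i2 // mul0mx mulmx0.
- by move=> i ij; apply: (full_cancel fg); rewrite eg i3 // mul0mx mulmx0.
- apply: (full_cancel fg); rewrite mulmx1 mulmx_sumr -{2}[g]mul1mx -i4 mulmx_suml.
  by apply: eq_bigr => l _.
- by move=> i; apply: (full_cancel fg); rewrite !mulmxA eg ag -(mulmxA _ g) ag mulmxA
     -(mulmxA _ g) eg mulmxA -i5.
- by move=> j l /i6 H; apply: (full_cancel fg); rewrite -(hom_pathm _ _ hg) H mul0mx mulmx0.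
Qed.

(** The splitting is over the field only: [f'] and [g'] need not be module maps. It turns exactness
    into matrix identities. *)
Lemma ses_split K P X f g : @ses k K P X f g ->
  exists f' g', [/\ f *m f' = 1%:M, g' *m g = 1%:M, f *m g = 0 & f' *m f + g *m g' = 1%:M].
Proof.
move=> [hf [hg [ff [fg /eqmxP fk]]]].
have fg0 : f *m g = 0 by apply/sub_kermxP; rewrite fk.
case/row_fullP: (fg) => g' Hg.
have : (1%:M - g *m g' <= f)%MS.
  by rewrite fk; apply/sub_kermxP; rewrite mulmxBl mul1mx -mulmxA Hg mulmx1 subrr.
case/submxP => f' Hf; exists f', g'; split => //.
  apply: (free_cancel ff); rewrite -mulmxA -Hf mulmxBr mulmxA fg0 mul0mx.
  by rewrite subr0 mulmx1 mul1mx.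
by rewrite -Hf subrK.
Qed.

Lemma split_ses K P X f g f' g' : @Hom k K P f -> @Hom k P X g ->
  f *m f' = 1%:M -> g' *m g = 1%:M -> f *m g = 0 -> f' *m f + g *m g' = 1%:M ->
  @ses k K P X f g.
Proof.
move=> hf hg Hf Hg fg H; split=> //; split => //; split; first by apply/row_freeP; exists f'.
split; first by apply/row_fullP; exists g'.
apply/andP; split; first by apply/sub_kermxP.
apply/submxP; exists (kermx g *m f').
by rewrite -[LHS]mulmx1 -H mulmxDr !mulmxA mulmx_ker mul0mx addr0.
Qed.

Lemma ses_mono K P X f g : @ses k K P X f g -> @Hom k K P f /\ row_free f.
Proof. by case=> ? [? []]. Qed.

Lemma ses_epi K P X f g : @ses k K P X f g -> @Hom k P X g /\ row_full g.
Proof. by case=> ? [? [? []]]. Qed.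

Lemma ses_factor_epi K P X Z f g t : @ses k K P X f g -> @Hom k P Z t -> f *m t = 0 ->
  exists s, @Hom k X Z s /\ g *m s = t.
Proof.
move=> S ht ft; case: (ses_split S) => f' [g' [H1 H2 H3 H4]]; case: (ses_epi S) => hg fg.
have E : g *m (g' *m t) = t.
  by rewrite -[RHS]mul1mx -H4 mulmxDl -mulmxA ft mulmx0 add0r mulmxA.
by exists (g' *m t); split => //; apply: (hom_epi_factor hg fg); rewrite E.
Qed.

Lemma ses_factor_mono K P X Z f g t : @ses k K P X f g -> @Hom k Z P t -> t *m g = 0 ->
  exists s, @Hom k Z K s /\ s *m f = t.
Proof.
move=> S ht tg; case: (ses_split S) => f' [g' [H1 H2 H3 H4]]; case: (ses_mono S) => hf ff.
have E : t *m f' *m f = t.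
  by rewrite -[RHS]mulmx1 -H4 mulmxDr !mulmxA tg mul0mx addr0.
by exists (t *m f'); split => //; apply: (hom_mono_factor hf ff); rewrite E.
Qed.

Definition retract X Y := exists s p, [/\ @Hom k X Y s, @Hom k Y X p & s *m p = 1%:M].

Lemma retract_refl X : retract X X.
Proof. by exists 1%:M, 1%:M; split; rewrite ?mulmx1 //; apply: hom1. Qed.

Lemma retract_trans Y X Z : retract X Y -> retract Y Z -> retract X Z.
Proof.
move=> [s [p [hs hp E]]] [s' [p' [hs' hp' E']]]; exists (s *m s'), (p' *m p).
by split; try exact: homM; rewrite -mulmxA (mulmxA s') E' mul1mx.
Qed.

Lemma retract_module L X Y : retract X Y -> is_module L Y -> is_module L X.
Proof.
move=> [s [p [hs hp E]]] H; apply: (module_epi H hp); apply/row_fullP; by exists s.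
Qed.

Lemma hom_dsum_inl X Y : @Hom k X (dsum X Y) (row_mx 1%:M 0).
Proof.
move=> i /=; rewrite !mul_row_block !mul_mx_row.
by rewrite !mulmx0 !mul0mx !mul1mx !mulmx1 !addr0.
Qed.

Lemma hom_dsum_inr X Y : @Hom k Y (dsum X Y) (row_mx 0 1%:M).
Proof.
move=> i /=; rewrite !mul_row_block !mul_mx_row.
by rewrite !mulmx0 !mul0mx !mul1mx !mulmx1 !add0r.
Qed.

Lemma hom_col_mx X Y Z f g : @Hom k X Z f -> @Hom k Y Z g -> @Hom k (dsum X Y) Z (col_mx f g).
Proof.
move=> hf hg i /=; case: (hf i) (hg i) => a b [c d].
by rewrite !mul_block_col !mul_col_mx !mul0mx !addr0 !add0r a b c d.
Qed.

Lemma hom_row_mx X Y Z f g : @Hom k Z X f -> @Hom k Z Y g -> @Hom k Z (dsum X Y) (row_mx f g).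
Proof.
move=> hf hg i /=; case: (hf i) (hg i) => a b [c d].
by rewrite !mul_row_block !mul_mx_row !mulmx0 !addr0 !add0r a b c d.
Qed.

Lemma row_mx_col_mx1 (m n p : nat) (f : 'M[k]_(m, p)) (g : 'M[k]_(n, p)) :
  row_mx 1%:M 0 *m col_mx f g = f.
Proof. by rewrite mul_row_col mul1mx mul0mx addr0. Qed.

Lemma row_mx_col_mx2 (m n p : nat) (f : 'M[k]_(m, p)) (g : 'M[k]_(n, p)) :
  row_mx 0 1%:M *m col_mx f g = g.
Proof. by rewrite mul_row_col mul1mx mul0mx add0r. Qed.

Lemma hom_dsum_prl X Y : @Hom k (dsum X Y) X (col_mx 1%:M 0).
Proof. by apply: hom_col_mx; [apply: hom1 | apply: hom0]. Qed.

Lemma hom_dsum_prr X Y : @Hom k (dsum X Y) Y (col_mx 0 1%:M).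
Proof. by apply: hom_col_mx; [apply: hom0 | apply: hom1]. Qed.

Lemma hom_block X Y X' Y' f g : @Hom k X X' f -> @Hom k Y Y' g ->
  @Hom k (dsum X Y) (dsum X' Y') (block_mx f 0 0 g).
Proof.
move=> hf hg i /=; case: (hf i) (hg i) => a b [c d].
by rewrite !mulmx_block !mulmx0 !mul0mx !addr0 !add0r a b c d.
Qed.

Lemma retract_inl X Y : retract X (dsum X Y).
Proof.
exists (row_mx 1%:M 0), (col_mx 1%:M 0); split; rewrite ?row_mx_col_mx1 //.
  exact: hom_dsum_inl. exact: hom_dsum_prl.
Qed.

Lemma retract_inr X Y : retract Y (dsum X Y).
Proof.
exists (row_mx 0 1%:M), (col_mx 0 1%:M); split; rewrite ?row_mx_col_mx2 //.
  exact: hom_dsum_inr. exact: hom_dsum_prr.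
Qed.

Lemma block_mx1 m n : block_mx 1%:M 0 0 1%:M = 1%:M :> 'M[k]_(m + n).
Proof. by rewrite -scalar_mx_block. Qed.

Lemma retract_dsum X Y X' Y' : retract X X' -> retract Y Y' -> retract (dsum X Y) (dsum X' Y').
Proof.
move=> [s [p [hs hp E]]] [s' [p' [hs' hp' E']]].
exists (block_mx s 0 0 s'), (block_mx p 0 0 p'); split; try exact: hom_block.
by rewrite mulmx_block !mulmx0 !mul0mx !addr0 !add0r E E' block_mx1.
Qed.

Lemma retract_inseq X Ys : List.In X Ys -> retract X (dsum_list Ys).
Proof.
elim: Ys => //= Y Ys IH [->|/IH H]; first exact: retract_inl.
exact: retract_trans H (retract_inr _ _).
Qed.

End Homomorphisms.

(** * Interval modules and their homomorphisms *)

Section Intervals.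
Local Open Scope ring_scope.
Variable k : fieldType.
Implicit Types X Y Z E K P Q M N : rep k.
Implicit Types (u v w s t : int) (S T : pred int).

(* Matrices that send the basis vector at vertex w of ]u, v] to the one at vertex w - s of ]u', v'],
   provided that S w holds. *)
Definition shiftmx u v u' v' s S : 'M[k]_(`|v - u|, `|v' - u'|) :=
  \matrix_(x, y) ((v' - y%:Z == v - x%:Z - s) && S (v - x%:Z))%:R.

Lemma shiftmx_eq u v u' v' s S T : u <= v -> u' <= v' ->
  (forall w, u < w <= v -> u' < w - s <= v' -> S w = T w) ->
  shiftmx u v u' v' s S = shiftmx u v u' v' s T.
Proof.
move=> uv uv' H; apply/matrixP => x y; rewrite !mxE; case: eqP => //= E; rewrite H //.
- by have := ltn_ord x; lia.
- by have := ltn_ord y; lia.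
Qed.

(** Idempotents, arrows and canonical maps are all shifts, so identities between their composites
    reduce to linear arithmetic on w by [shiftmx_eq]. *)
Lemma shiftmxM u v u' v' u'' v'' s t S T : u' <= v' ->
  shiftmx u v u' v' s S *m shiftmx u' v' u'' v'' t T =
  shiftmx u v u'' v'' (s + t) (fun w => [&& S w, u' < w - s <= v' & T (w - s)]).
Proof.
move=> uv'; apply/matrixP => x z; rewrite !mxE; set w := v - x%:Z.
case: (boolP (u' < w - s <= v')) => H; last first.
  rewrite big1 ?andbF // => y _; rewrite !mxE -/w.
  by case: eqP => [E|]; rewrite ?mul0r // -E in H *; have := ltn_ord y; lia.
have Hy : (`|v' - (w - s)%R| < `|v' - u'|)%N by lia.
have Ey : v' - (`|v' - (w - s)%R|%N)%:Z = w - s by lia.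
rewrite (bigD1 (Ordinal Hy)) //= big1 ?addr0 => [|y ny].
  rewrite !mxE -/w /= Ey eqxx /= -natrM mulnb; congr (nat_of_bool _)%:R.
  by rewrite opprD addrA; case: (S w); case: (T _); rewrite ?andbF ?andbT.
rewrite !mxE -/w; case: eqP => [E|_]; last by rewrite mul0r.
by case/eqP: ny; apply: val_inj => /=; have := ltn_ord y; lia.
Qed.

Lemma shiftmx1 u v : shiftmx u v u v 0 predT = 1%:M.
Proof.
apply/matrixP => x y; rewrite !mxE andbT -val_eqE /=; congr (nat_of_bool _)%:R.
by apply/eqP/eqP; have := ltn_ord y; have := ltn_ord x; lia.
Qed.

Lemma shiftmx0 u v u' v' s S : u <= v -> u' <= v' ->
  (forall w, u < w <= v -> u' < w - s <= v' -> S w = false) -> shiftmx u v u' v' s S = 0.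
Proof.
move=> uv uv' H; rewrite (@shiftmx_eq _ _ _ _ _ _ pred0) //.
by apply/matrixP => x y; rewrite !mxE andbF.
Qed.

Lemma shiftmxD u v u' v' s S T : u <= v ->
  (forall w, u < w <= v -> S w && T w = false) ->
  shiftmx u v u' v' s S + shiftmx u v u' v' s T = shiftmx u v u' v' s (predU S T).
Proof.
move=> uv H; apply/matrixP => x y; rewrite !mxE /= -natrD; congr (_%:R); case: eqP => //= _.
have := H (v - x%:Z); case: (S _) => //=; case: (T _) => //= /(_ _).
by have := ltn_ord x; lia.
Qed.

(* The uniserial module with composition factors S_w, u < w <= v, and top S_v. *)
Definition itv u v : rep k :=
  @Rep k `|v - u| (fun i => shiftmx u v u v 0 (pred1 i)) (fun i => shiftmx u v u v 1 (pred1 i)).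

Definition itv_map u v u' v' : 'M[k]_(rdim (itv u v), rdim (itv u' v')) :=
  shiftmx u v u' v' 0 predT.

Lemma itv_map_hom u v u' v' : u <= v -> u' <= v' -> u <= u' -> v <= v' ->
  @Hom k (itv u v) (itv u' v') (itv_map u v u' v').
Proof.
move=> uv uv' uu vv i; rewrite /itv_map /=; rewrite !shiftmxM ?add0r ?addr0 //; split.
  by apply: shiftmx_eq => // w; rewrite /= subr0; lia.
by apply: shiftmx_eq => // w; rewrite /= subr0; lia.
Qed.

Lemma itv_pathm u v j l : u <= v ->
  pathm (itv u v) j l = shiftmx u v u v l%:Z (pred1 j).
Proof.
move=> uv; elim: l j => [|l IH] j //=; rewrite IH shiftmxM // -intS.
by apply: shiftmx_eq => // w /=; lia.
Qed.

Lemma module_idem L X i j : is_module L X -> ridem X i *m ridem X j = if i == j then ridem X i else 0.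
Proof. by move=> [i1 [i2 _]]; case: eqP => [<-|/eqP /i2]. Qed.

Lemma module_idem_arr L X i j : is_module L X -> ridem X i *m rarr X j = if i == j then rarr X j else 0.
Proof.
move=> H; have [_ [_ [_ [_ [-> _]]]]] := H; rewrite !mulmxA (module_idem _ _ H).
by case: eqP => [->|] //; rewrite !mul0mx.
Qed.

Lemma module_arr_idem L X i j : is_module L X ->
  rarr X j *m ridem X i = if i == j - 1 then rarr X j else 0.
Proof.
move=> H; have [_ [_ [_ [_ [-> _]]]]] := H; rewrite -!mulmxA (module_idem _ _ H) eq_sym.
by case: eqP => // _; rewrite !mulmx0.
Qed.

Lemma pathm_idem L X i j l : is_module L X ->
  pathm X j l *m ridem X i = if i == j - l%:Z then pathm X j l else 0.
Proof.
move=> H; elim: l j => [|l IH] j /=.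
  by rewrite (module_idem _ _ H) subr0 eq_sym.
rewrite -mulmxA IH intS opprD addrA; case: eqP => // _; exact: mulmx0.
Qed.

Lemma idem_pathm L X i j l : is_module L X ->
  ridem X i *m pathm X j l = if i == j then pathm X j l else 0.
Proof.
move=> H; case: l => [|l] /=; first by rewrite (module_idem _ _ H); case: eqP => [->|].
by rewrite mulmxA (module_idem_arr _ _ H); case: eqP => // _; exact: mul0mx.
Qed.

Lemma pathm_cat L X j l l' : is_module L X ->
  pathm X j (l + l') = pathm X j l *m pathm X (j - l%:Z) l'.
Proof.
move=> H; elim: l j => [|l IH] j /=; first by rewrite add0n subr0 (idem_pathm _ _ _ H) eqxx.
by rewrite IH mulmxA intS opprD addrA.
Qed.

Lemma pathm_arr L X i j l : is_module L X ->
  pathm X j l *m rarr X i = if i == j - l%:Z then pathm X j l.+1 else 0.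
Proof.
move=> H; have E1 : pathm X i 1 = rarr X i by rewrite /= (module_arr_idem _ _ H) eqxx.
case: eqP => [E|ni].
  by rewrite -addn1 (pathm_cat _ _ _ H) -E E1.
have [_ [_ [_ [_ [-> _]]]]] := H; rewrite !mulmxA (pathm_idem _ _ _ H).
by case: eqP => // _; rewrite !mul0mx.
Qed.

Lemma pathm_out L X j l : is_module L X -> ~~ valid_path (na_a L) (na_b L) j l -> pathm X j l = 0.
Proof.
move=> H nv; have [_ [_ [o _]]] := H.
have [jo|lo] : ((j < na_a L) || (na_b L < j)) \/ ((j - l%:Z < na_a L) || (na_b L < j - l%:Z)).
- by move: nv; rewrite /valid_path; lia.
- by have := idem_pathm j j l H; rewrite eqxx => <-; rewrite o // mul0mx.
- by have := pathm_idem (j - l%:Z) j l H; rewrite eqxx => <-; rewrite o // mulmx0.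
Qed.

(** The top vector goes to [y] and the vector x steps below it to [y] times the path of length x;
    the hypothesis makes this compatible with the arrow leaving the interval. *)
Lemma itv_hom_from L X u v (y : 'rV[k]_(rdim X)) : is_module L X -> u <= v ->
  y *m pathm X v `|v - u| = 0 ->
  @Hom k (itv u v) X (\matrix_(x < `|v - u|) (y *m pathm X v x)).
Proof.
move=> H uv y0 i; split; apply/row_matrixP => x; rewrite !row_mul rowK.
- rewrite -mulmxA (pathm_idem _ _ _ H); apply/rowP => z; rewrite !mxE (bigD1 x) //= big1.
    rewrite !mxE subr0 eqxx addr0 /= eq_sym; case: eqP => _; rewrite ?mul1r ?mul0r ?mxE //.
    by rewrite big1 // => ? _; rewrite mxE mulr0.
  move=> t /negP nt; rewrite !mxE; case: eqP => [E|]; rewrite ?mul0r //.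
  by case: nt; rewrite -val_eqE /=; lia.
- rewrite -mulmxA (pathm_arr _ _ _ H); apply/rowP => z.
  case: (ltnP x.+1 `|v - u|) => Hx.
    rewrite !mxE (bigD1 (Ordinal Hx)) //= big1 => [|t /negP nt].
      rewrite !mxE addr0 /=.
      have -> : v - x.+1%:Z = v - x%:Z - 1 by lia.
      rewrite eqxx [i == _]eq_sym /=.
      case: (v - x%:Z =P i) => _; rewrite ?mul1r ?mul0r ?mxE //.
      by rewrite big1 // => ? _; rewrite mxE mulr0.
    rewrite !mxE; case: eqP => [E|]; rewrite ?mul0r //.
    by case: nt; rewrite -val_eqE /=; lia.
  have E : x.+1 = `|v - u|%N by apply/eqP; rewrite eqn_leq Hx ltn_ord.
  have -> : y *m (if i == v - x%:Z then pathm X v x.+1 else 0) = 0.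
    by rewrite E; case: ifP => _; rewrite ?y0 ?mulmx0.
  rewrite !mxE big1 // => t _.
  by rewrite !mxE; case: eqP => [E0|]; rewrite ?mul0r //; have := ltn_ord t; simpl in *; lia.
Qed.

Definition vtx u v w : 'rV[k]_`|v - u| := \row_y (v - y%:Z == w)%:R.

Lemma vtx0 u v w : u <= v -> ~~ (u < w <= v) -> vtx u v w = 0.
Proof.
move=> uv H; apply/rowP => y; rewrite !mxE; case: eqP => // E.
by have := ltn_ord y; lia.
Qed.

Lemma vtx_neq0 u v w : u < w <= v -> vtx u v w != 0.
Proof.
move=> H; have Hx : (`|v - w| < `|v - u|)%N by lia.
apply/eqP => /rowP /(_ (Ordinal Hx)); rewrite !mxE /=.
case: eqP => [_|]; last by lia.
by move/eqP; rewrite oner_eq0.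
Qed.

Lemma row_vtx u v x (f : 'M[k]_(`|v - u|, x)) (i : 'I_`|v - u|) :
  row i f = vtx u v (v - i%:Z) *m f.
Proof.
apply/rowP => z; rewrite !mxE (bigD1 i) //= big1 ?addr0; first by rewrite mxE eqxx mul1r.
move=> j /negP nj; rewrite mxE; case: eqP => [E|]; rewrite ?mul0r //.
by case: nj; rewrite -val_eqE /=; lia.
Qed.

Lemma vtx_shift u v u' v' w s S : u <= v ->
  vtx u v w *m shiftmx u v u' v' s S = if (u < w <= v) && S w then vtx u' v' (w - s) else 0.
Proof.
move=> uv; case: (boolP (u < w <= v)) => H /=; last by rewrite vtx0 // mul0mx.
have Hx : (`|v - w| < `|v - u|)%N by lia.
have E : w = v - (Ordinal Hx)%:Z by rewrite /=; lia.
rewrite {1}E -row_vtx; apply/rowP => z; rewrite !mxE -E eq_sym.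
by case: (S w); rewrite ?andbF ?andbT ?mxE // eq_sym.
Qed.

Lemma vtx_fixed u v w (r : 'rV[k]_`|v - u|) : u < w <= v ->
  r *m shiftmx u v u v 0 (pred1 w) = r -> exists a, r = a *: vtx u v w.
Proof.
move=> H E; have Hx : (`|v - w| < `|v - u|)%N by lia.
exists (r 0 (Ordinal Hx)); apply/rowP => z; rewrite !mxE.
case: eqP => [Ez|nz].
  by rewrite mulr1; congr (r 0 _); apply: val_inj => /=; have := ltn_ord z; lia.
rewrite mulr0 -E mxE big1 // => y _; rewrite !mxE /= subr0.
by case: eqP => [E1|]; case: eqP => [E2|]; rewrite ?mulr0 //; lia.
Qed.

Lemma itv_hom_ext X u v f f' : u <= v -> @Hom k (itv u v) X f -> @Hom k (itv u v) X f' ->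
  vtx u v v *m f = vtx u v v *m f' -> f = f'.
Proof.
move=> uv hf hf' E; apply/row_matrixP => i; rewrite !row_vtx.
have -> : vtx u v (v - i%:Z) = vtx u v v *m pathm (itv u v) v i.
  rewrite itv_pathm // vtx_shift //= eqxx lexx andbT andbT; case: ltP => //.
  by have := ltn_ord i; simpl in *; lia.
by rewrite -!mulmxA !(hom_pathm _ _ hf, hom_pathm _ _ hf') !mulmxA E.
Qed.

Lemma itv_hom_exists L X u v (y : 'rV[k]_(rdim X)) : is_module L X -> u < v ->
  y *m ridem X v = y -> y *m pathm X v `|v - u| = 0 ->
  exists h, @Hom k (itv u v) X h /\ vtx u v v *m h = y.
Proof.
move=> H uv ye yp; exists (\matrix_(x < `|v - u|) (y *m pathm X v x)); split.
  by apply: (itv_hom_from H) => //; lia.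
have Hx : (0 < `|v - u|)%N by lia.
have E : v = v - (Ordinal Hx)%:Z by rewrite subr0.
by rewrite {3}E -row_vtx rowK.
Qed.

(** The image of the top vector lies in the at most one-dimensional space at v. If u' < u, the path
    of length v - u kills the top vector but no nonzero vector at v in the target. *)
Lemma itv_hom_scal u v u' v' f : u < v -> u' <= v' -> @Hom k (itv u v) (itv u' v') f ->
  f = 0 \/ [/\ u <= u', u' < v, v <= v' & exists a, f = a *: itv_map u v u' v'].
Proof.
move=> uv uv' hf; set r := vtx u v v *m f.
have uv1 := ltW uv.
have re : r *m ridem (itv u' v') v = r.
  rewrite /r -mulmxA -(proj1 (hf v)) mulmxA /= vtx_shift //= eqxx lexx uv /=.
  by rewrite subr0.
have f0 : r = 0 -> f = 0.
  by move=> r0; apply: (itv_hom_ext uv1 hf (hom0 _ _)); rewrite -/r r0 mulmx0.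
case: (boolP (u' < v <= v')) => H; last first.
  left; apply: f0; rewrite -re /= shiftmx0 ?mulmx0 // => w _.
  by rewrite /= subr0; lia.
have [a Ea] := vtx_fixed H re.
case: (lerP u u') => uu; [right | left].
  split => //; [by lia | by lia | exists a].
  apply: (itv_hom_ext uv1 hf); first by apply: homZ; apply: itv_map_hom => //; lia.
  by rewrite -/r Ea -scalemxAr /itv_map vtx_shift //= lexx uv subr0.
apply: f0; rewrite Ea.
have : r *m pathm (itv u' v') v `|v - u| = 0.
  rewrite /r -mulmxA -(hom_pathm _ _ hf) mulmxA itv_pathm // vtx_shift //= eqxx lexx uv /=.
  by rewrite vtx0 ?mul0mx //; lia.
rewrite Ea -scalemxAl itv_pathm // vtx_shift //= eqxx H /=.
have -> : v - `|v - u|%N%:Z = u by lia.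
move/eqP; rewrite scalemx_eq0 => /orP [/eqP ->|]; first by rewrite scale0r.
by rewrite (negbTE (vtx_neq0 _)) //; lia.
Qed.

Lemma row_neq0_dual n (z : 'rV[k]_n) : z != 0 -> exists c : 'cV[k]_n, z *m c = 1%:M.
Proof.
move=> nz; have [i ni] : exists i, z 0 i != 0.
  apply: NNPP => H; case/eqP: nz; apply/rowP => i; rewrite mxE; apply/eqP/negPn/negP => Hi.
  by apply: H; exists i.
exists ((z 0 i)^-1 *: delta_mx i 0); apply/matrixP => p q; rewrite !ord1 !mxE.
rewrite (bigD1 i) //= big1 ?addr0; first by rewrite !mxE !eqxx mulr1 mulfV.
by move=> j /negbTE nj; rewrite !mxE nj /= !mulr0.
Qed.

(* A path of maximal length acting nontrivially yields a uniserial direct summand: it is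
   projective and injective over the quotient of the algebra by the longer paths. *)
Lemma itv_retract_max L X j l : is_module L X -> pathm X j l != 0 ->
  (forall j', pathm X j' l.+1 = 0) -> retract (itv (j - l.+1%:Z) j) X.
Proof.
move=> H nz mx.
have [y0 yz] : exists y : 'rV_(rdim X), y *m pathm X j l != 0.
  apply: NNPP => Hy; case/eqP: nz; apply/row_matrixP => i; rewrite row0 rowE.
  by apply/eqP/negPn/negP => Hi; apply: Hy; exists (delta_mx 0 i).
set y := y0 *m ridem X j.
have ye : y *m ridem X j = y by rewrite /y -mulmxA (module_idem _ _ H) eqxx.
have yp : y *m pathm X j l = y0 *m pathm X j l.
  by rewrite /y -mulmxA (idem_pathm _ _ _ H) eqxx.
rewrite -yp in yz; have [c Hc] := row_neq0_dual yz.
set u := j - l.+1%:Z; have uj : u < j by rewrite /u; lia.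
have du : `|j - u|%N = l.+1 by rewrite /u; lia.
have [|h [hh hy]] := itv_hom_exists H uj ye; first by rewrite du mx mulmx0.
(* The coefficient at vertex j - x is read off by walking the remaining l - x steps down and
   applying the functional [c], normalized on the end of the path from [y]. *)
pose r := (\matrix_(p < rdim X, x < `|j - u|) (pathm X (j - x%:Z) (l - x) *m c) p 0).
have hr : @Hom k X (itv u j) r.
  have rE (A : 'M_(rdim X)) p x :
      (A *m r) p x = (A *m (pathm X (j - x%:Z) (l - x) *m c)) p 0.
    by rewrite !mxE; apply: eq_bigr => q _; rewrite mxE.
  move=> i; split; apply/matrixP => p x; rewrite rE.
    rewrite mulmxA (idem_pathm _ _ _ H) [RHS]mxE (bigD1 x) //= big1 => [|t /negP nt].
      rewrite !mxE subr0 eqxx addr0 /= eq_sym.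
      case: eqP => _; rewrite ?mulr1 ?mulr0 ?mul0mx ?mxE //.
      by rewrite big1 // => ? _; rewrite mxE mul0r.
    rewrite !mxE; case: eqP => [E|]; rewrite ?mulr0 //.
    by case: nt; rewrite -val_eqE /=; lia.
  have xl : (x < l.+1)%N by rewrite -du ltn_ord.
  have -> : rarr X i *m (pathm X (j - x%:Z) (l - x) *m c) =
     if i == j - x%:Z + 1 then pathm X i (l - x).+1 *m c else 0.
    case: eqP => [E|nE]; first by rewrite mulmxA /=; have -> : i - 1 = j - x%:Z by lia.
    have := module_arr_idem (i - 1) i H; rewrite eqxx => <-.
    rewrite -mulmxA !(mulmxA (ridem X _)) (idem_pathm _ _ _ H).
    by case: eqP => [E'|]; [lia | rewrite mul0mx mulmx0].
  case: x xl => [[|x] Hx] xl; rewrite [nat_of_ord _]/=.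
    (* At the top, x = 0, the arrow from j + 1 would give a path of length l + 1, which is zero by
       maximality. *)
    rewrite subn0 mx mul0mx if_same !mxE big1 // => t _; rewrite !mxE.
    by case: eqP => [E|]; rewrite ?mulr0 //; simpl in *; lia.
  have Hx' : (x < `|j - u|)%N by simpl in *; lia.
  rewrite subnSK // [RHS]mxE (bigD1 (Ordinal Hx')) //= big1 => [|t /negP nt].
    rewrite addr0 !mxE /=.
    have -> : j - x.+1%:Z = j - x%:Z - 1 by lia.
    rewrite eqxx subrK /= [i == _]eq_sym; case: eqP => [<-|_]; rewrite ?mulr1 ?mulr0 ?mxE //.
  rewrite !mxE; case: eqP => [E|]; rewrite ?mulr0 //.
  by case: nt; rewrite -val_eqE /=; simpl in *; lia.
exists h, r; split => //.
have uj1 := ltW uj.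
apply: (itv_hom_ext uj1); [exact: homM hh hr | exact: hom1 | ].
rewrite mulmxA hy mulmx1; apply/rowP => x.
have -> : (y *m r) 0 x = (y *m (pathm X (j - x%:Z) (l - x) *m c)) 0 0.
  by rewrite mxE [RHS]mxE; apply: eq_bigr => q _; congr (_ * _); rewrite mxE.
rewrite -ye -mulmxA (mulmxA (ridem X j)) (idem_pathm _ _ _ H) [RHS]mxE.
case: (eqVneq (nat_of_ord x) 0%N) => [x0|nx].
  by rewrite x0 subr0 eqxx subn0 mulmxA Hc mxE.
rewrite ifN; last by apply/eqP; lia.
by rewrite mul0mx mulmx0 mxE; case: eqP => // E; exfalso; move: nx; simpl in *; lia.
Qed.
End Intervals.

(** * The ideal encoded by the lower ends of the projectives *)

Section ProjectiveBound.
Local Open Scope ring_scope.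
Variable L : nakalg.
Implicit Types (u v w j : int) (l : nat).

Lemma low_subproof v : exists l, na_z L v l || (v - l%:Z < na_a L).
Proof. by exists `|v - na_a L|.+1; apply/orP; right; lia. Qed.

(* The indecomposable projective with top S_v is the interval with composition factors S_w,
   low v < w <= v. *)
Definition low v : int := v - (ex_minn (low_subproof v))%:Z.

(** A path acts as zero if it is in the ideal or leaves the quiver (where [na_z] is false by
    convention); by [na_ideal] both persist under lengthening, so one threshold decides. *)
Lemma lowP v l : v <= na_b L -> (na_z L v l || (v - l%:Z < na_a L)) = (v - l%:Z <= low v).
Proof.
move=> vb; rewrite /low; case: ex_minnP => m Hm mm; apply/idP/idP => [/mm|]; first by lia.
move=> ml; have {ml}ml : (m <= l)%N by lia.
case: (ltP (v - l%:Z) (na_a L)) => [_|al]; first by rewrite orbT.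
rewrite orbF; case/orP: Hm => [Hm|]; last by lia.
apply: na_ideal Hm; rewrite ?lexx //; last by lia.
by rewrite /valid_path al vb.
Qed.

Lemma low_le v : low v <= v.
Proof. by rewrite /low; lia. Qed.

Lemma low_ge v : na_a L - 1 <= v -> na_a L - 1 <= low v.
Proof.
move=> av; rewrite /low; case: ex_minnP => m _ mm.
have := mm `|(v - na_a L + 1)%R|%N; have -> : v - `|(v - na_a L + 1)%R|%N%:Z < na_a L by lia.
by rewrite orbT => /(_ isT); lia.
Qed.

Lemma low_attained v : na_z L v `|v - low v| || (low v < na_a L).
Proof.
rewrite /low; case: ex_minnP => m Hm _.
by have -> : `|v - (v - m%:Z)%R|%N = m by lia.
Qed.

Lemma low_mono v v' : na_a L - 1 <= v -> v <= v' -> v' <= na_b L -> low v <= low v'.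
Proof.
move=> av vv vb; have av' : na_a L - 1 <= v' by lia.
have lv := low_le v; have lg := low_ge av'.
case/orP: (low_attained v) => [Hz|]; last by lia.
have al : na_a L <= low v.
  apply: contraT => nl; have nv : ~~ valid_path (na_a L) (na_b L) v `|v - low v|.
    by rewrite /valid_path; lia.
  by have := na_canon nv; rewrite Hz.
have := lowP `|v' - low v| vb.
have -> : na_z L v' `|v' - low v|.
  apply: na_ideal Hz => //; rewrite /valid_path; lia.
by move/esym; lia.
Qed.

Lemma low_lt v : na_a L <= v -> v <= na_b L -> low v < v.
Proof.
move=> av vb; have := lowP 0 vb; have [/negbTE -> _] := na_adm L v; lia.
Qed.

Lemma low_lt2 v : na_a L < v -> v <= na_b L -> low v <= v - 2.
Proof.
move=> av vb; have := lowP 1 vb; have [_ /negbTE ->] := na_adm L v; lia.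
Qed.
End ProjectiveBound.

(** * Projective intervals and decomposition of modules into intervals *)

Section Decomposition.
Local Open Scope ring_scope.
Variables (k : fieldType) (L : nakalg).
Implicit Types X Y Z E K P Q M N : rep k.
Implicit Types (u v w : int).

(** The case u = v, the zero module, is allowed so that syzygies of projective intervals stay
    valid. *)
Definition valid_itv u v := [&& na_a L - 1 <= u, low L v <= u, u <= v & v <= na_b L].

Lemma itv_module u v : valid_itv u v -> is_module L (itv k u v).
Proof.
case/and4P => au lu uv vb; split; [|split; [|split; [|split; [|split]]]] => /=.
- move=> i; rewrite shiftmxM // addr0; apply: shiftmx_eq => // w /=; lia.
- move=> i j ij; rewrite shiftmxM //; apply: shiftmx0 => // w /=; lia.
- by move=> i io; apply: shiftmx0 => // w /=; lia.
- apply/matrixP => x y; rewrite summxE -shiftmx1 !mxE andbT.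
  have ab := na_ab L.
  have Hx : (`|(v - x%:Z - na_a L)%R| < `|na_b L - na_a L|.+1)%N.
    by have := ltn_ord x; simpl in *; lia.
  rewrite (bigD1 (Ordinal Hx)) //= big1 => [|l /negP nl].
    rewrite mxE addr0; case: eqP => //= _.
    have -> : na_a L + `|(v - x%:Z - na_a L)%R|%N%:Z = v - x%:Z.
      by have := ltn_ord x; simpl in *; lia.
    by rewrite eqxx.
  rewrite mxE; case: eqP => //= _; case: eqP => // E; case: nl.
  by rewrite -val_eqE /=; lia.
- move=> i; rewrite !shiftmxM // add0r addr0; apply: shiftmx_eq => // w /=; lia.
- move=> j l Hz; rewrite itv_pathm //; apply: shiftmx0 => // w Hw Hw' /=.
  apply/eqP => E; rewrite -E in Hz.
  have : w - l%:Z <= low L w by rewrite -lowP ?Hz //; lia.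
  have := @low_mono L w v; lia.
Qed.

(** The longest path inside ]u, v] has length v - u - 1 and acts nontrivially, so it is a path of
    the quiver outside the ideal. *)
Lemma module_itv u v : u < v -> is_module L (itv k u v) -> valid_itv u v.
Proof.
move=> uv H; have uv1 := ltW uv.
have nz : pathm (itv k u v) v `|v - u|.-1 <> 0.
  rewrite itv_pathm // => E.
  have := vtx_shift k u v v `|v - u|.-1%:Z (pred1 v) uv1.
  rewrite E mulmx0 lexx uv /= eqxx => /esym/eqP.
  by rewrite (negbTE (vtx_neq0 _ _)) //; lia.
have vp : valid_path (na_a L) (na_b L) v `|v - u|.-1.
  by apply: contraT => /(pathm_out H).
have nzz : ~~ na_z L v `|v - u|.-1.
  by apply/negP => Hz; have [_ [_ [_ [_ [_ /(_ _ _ Hz)]]]]] := H.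
move: vp; rewrite /valid_path => /andP [va vb].
have := lowP `|v - u|.-1 vb; rewrite (negbTE nzz) /valid_itv; lia.
Qed.

Lemma low_pathm X v : is_module L X -> na_a L - 1 <= v -> v <= na_b L ->
  pathm X v `|v - low L v| = 0.
Proof.
move=> H av vb; case/orP: (low_attained L v) => [Hz|lo].
  by have [_ [_ [_ [_ [_ /(_ _ _ Hz)]]]]] := H.
apply: (pathm_out H); rewrite /valid_path; have := low_le L v; lia.
Qed.

Lemma itv_projective v : na_a L - 1 <= v -> v <= na_b L -> projective L (itv k (low L v) v).
Proof.
move=> av vb; have lv := low_le L v; split.
  by apply: itv_module; rewrite /valid_itv lexx low_ge // lv vb.
move=> M N g h HM HN hg /row_fullP [g' Hg] hh.
move: lv; rewrite le_eqVlt => /orP [/eqP lv|lv].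
  exists 0; split; first exact: hom0.
  apply: (itv_hom_ext _ (homM (hom0 _ _) hg) hh); first by rewrite lv.
  by rewrite vtx0 ?mul0mx // lv // ltxx.
set y := vtx k (low L v) v v *m h.
have ye : y *m ridem N v = y.
  rewrite /y -mulmxA -(proj1 (hh v)) mulmxA /= vtx_shift ?(ltW lv) //=.
  by rewrite eqxx lexx lv /= subr0.
(* The section [g'] is only linear; the idempotent moves the preimage of [y] to vertex v, and it
   remains a preimage because [g] commutes with idempotents. *)
have [||h' [hh' Eh]] := itv_hom_exists (y := y *m g' *m ridem M v) HM lv.
- by rewrite -mulmxA (module_idem _ _ HM) eqxx.
- by rewrite low_pathm // mulmx0.
exists h'; split => //; apply: (itv_hom_ext (ltW lv) (homM hh' hg) hh).
by rewrite mulmxA Eh -mulmxA (proj1 (hg v)) mulmxA -(mulmxA y) Hg mulmx1.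
Qed.

Lemma zero_module : is_module L (zero_rep k).
Proof. by repeat split => *; apply/matrixP; case. Qed.

Lemma dsum_module X Y : is_module L X -> is_module L Y -> is_module L (dsum X Y).
Proof.
move=> [i1 [i2 [i3 [i4 [i5 i6]]]]] [j1 [j2 [j3 [j4 [j5 j6]]]]].
have B0 : block_mx 0 0 0 0 = 0 :> 'M[k]_(rdim X + rdim Y).
  by rewrite /block_mx !row_mx0 col_mx0.
split; [|split; [|split; [|split; [|split]]]] => /=.
- by move=> i; rewrite mulmx_block !mulmx0 !mul0mx !addr0 add0r i1 j1.
- by move=> i j ij; rewrite mulmx_block !mulmx0 !mul0mx !addr0 i2 // j2 // addr0 B0.
- by move=> i io; rewrite i3 // j3 // B0.
- have F n (f : 'I_n -> 'M[k]_(rdim X)) (f' : 'I_n -> 'M[k]_(rdim Y)) :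
    \sum_l block_mx (f l) 0 0 (f' l) = block_mx (\sum_l f l) 0 0 (\sum_l f' l).
    elim: n f f' => [|n IH] f f'; first by rewrite !big_ord0 B0.
    by rewrite !big_ord_recl IH add_block_mx !addr0.
  by rewrite F i4 j4 block_mx1.
- by move=> i; rewrite !mulmx_block !mulmx0 !mul0mx !addr0 !mul0mx !add0r -i5 -j5.
- move=> j l Hz.
  have -> : pathm (dsum X Y) j l = block_mx (pathm X j l) 0 0 (pathm Y j l).
    elim: l j {Hz} => //= l IH j; rewrite IH mulmx_block !mulmx0 !mul0mx !addr0 add0r //.
  by rewrite i6 // j6 // B0.
Qed.

Lemma dsum_list_module Ys : (forall Y, List.In Y Ys -> is_module L Y) -> is_module L (dsum_list Ys).
Proof.
elim: Ys => [|Y Ys IH] H /=; first exact: zero_module.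
by apply: dsum_module; [apply: H; left | apply: IH => Z HZ; apply: H; right].
Qed.

Definition iso X Y := exists s p,
  [/\ @Hom k X Y s, @Hom k Y X p, s *m p = 1%:M & p *m s = 1%:M].

Lemma iso_retract X Y : iso X Y -> retract X Y.
Proof. by move=> [s [p [? ? ? ?]]]; exists s, p. Qed.

Lemma iso_sym X Y : iso X Y -> iso Y X.
Proof. by move=> [s [p [? ? ? ?]]]; exists p, s. Qed.

Lemma iso_trans Y X Z : iso X Y -> iso Y Z -> iso X Z.
Proof.
move=> [s [p [hs hp E F]]] [s' [p' [hs' hp' E' F']]]; exists (s *m s'), (p' *m p).
split; try exact: homM; first by rewrite -mulmxA (mulmxA s') E' mul1mx.
by rewrite -mulmxA (mulmxA p) F mul1mx.
Qed.

Lemma iso_dsum X Y Y' : iso Y Y' -> iso (dsum X Y) (dsum X Y').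
Proof.
move=> [s [p [hs hp E F]]]; exists (block_mx 1%:M 0 0 s), (block_mx 1%:M 0 0 p).
split; try by apply: hom_block => //; apply: hom1.
all: by rewrite mulmx_block !mulmx0 !mul0mx !addr0 !add0r ?E ?F mul1mx block_mx1.
Qed.

(* The complement is carried by a row basis of the complementary idempotent. *)
Lemma retract_complement X U : retract U X ->
  exists X', iso X (dsum U X') /\ (rdim U + rdim X' = rdim X)%N.
Proof.
move=> [h [r [hh hr E]]].
pose q := 1%:M - r *m h.
have hq : @Hom k X X q by apply: homB; [apply: hom1 | apply: homM hr hh].
have qq : q *m q = q.
  rewrite /q mulmxBl mul1mx mulmxBr mulmx1 -mulmxA (mulmxA h) E mul1mx subrr.
  by rewrite subr0.
have hqr : h *m q = 0 by rewrite /q mulmxBr mulmx1 mulmxA E mul1mx subrr.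
have qr : q *m r = 0 by rewrite /q mulmxBl mul1mx -mulmxA E mulmx1 subrr.
have [d [w [c [cw fw fc]]]] : exists d (w : 'M[k]_(d, rdim X)) (c : 'M[k]_(rdim X, d)),
  [/\ c *m w = q, row_free w & row_full c].
  exists (\rank q), (row_base q), (col_base q).
  by split; [apply: mulmx_base | apply: row_base_free | apply: col_base_full].
have wc : w *m c = 1%:M.
  apply: (full_cancel fc); apply: (free_cancel fw).
  have -> : c *m (w *m c) *m w = (c *m w) *m (c *m w) by rewrite !mulmxA.
  by rewrite mulmx1 cw qq.
have hc0 : h *m c = 0 by apply: (free_cancel fw); rewrite mul0mx -mulmxA cw.
have wr0 : w *m r = 0 by apply: (full_cancel fc); rewrite mulmx0 mulmxA cw.
have wq : w *m q = w by rewrite -cw mulmxA wc mul1mx.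
have qc : q *m c = c by rewrite -cw -mulmxA wc mulmx1.
pose X' := @Rep k _ (fun i => w *m ridem X i *m c) (fun i => w *m rarr X i *m c).
have hw : @Hom k X' X w.
  move=> i; rewrite /X' /= -!mulmxA cw; case: (hq i) => a b.
  by rewrite a b !mulmxA wq.
have hc : @Hom k X X' c.
  move=> i; rewrite /X' /= !mulmxA cw; case: (hq i) => a b.
  by rewrite -a -b -!mulmxA qc.
exists X'.
have EE : col_mx h w *m row_mx r c = 1%:M.
  by rewrite mul_col_row E wc hc0 wr0 block_mx1.
have FF : row_mx r c *m col_mx h w = 1%:M.
  by rewrite mul_row_col cw /q addrC subrK.
split; last first.
  apply/eqP; rewrite eqn_leq -{1}(mxrank1 k (rdim U + _)) -{2}(mxrank1 k (rdim X)) -{1}EE -FF.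
  by apply/andP; split; apply: leq_trans (mxrankM_maxl _ _) (rank_leq_col _).
by exists (row_mx r c), (col_mx h w); split => //; [apply: hom_row_mx | apply: hom_col_mx].
Qed.

(** The idempotents sum to 1, so some path acts nontrivially on a nonzero module, and lengths are
    bounded by the quiver: a maximal length exists and splits off an interval. Induction is on the
    dimension. *)
Lemma module_decomposition X : is_module L X -> exists Is : seq (int * int),
  (forall p, p \in Is -> p.1 < p.2 /\ valid_itv p.1 p.2) /\
  iso X (dsum_list [seq itv k p.1 p.2 | p <- Is]).
Proof.
have [n le_n] := ubnP (rdim X); elim: n X le_n => // n IH X le_n H.
case: (posnP (rdim X)) => [X0|Xpos].
  exists [::]; split=> //; exists 0, 0.
  split; try exact: hom0; apply/matrixP; last by case.
  by move=> x; have := ltn_ord x; rewrite {2}X0.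
pose R l := exists j, pathm X j l != 0.
have R0 : R 0%N.
  apply: NNPP => nR; have [_ [_ [_ [i4 _]]]] := H.
  have : (1%:M : 'M[k]_(rdim X)) = 0.
    rewrite -i4 big1 // => l _; apply/eqP/negPn/negP => Hn; apply: nR.
    by exists (na_a L + l%:Z).
  move/matrixP => /(_ (Ordinal Xpos) (Ordinal Xpos)); rewrite !mxE eqxx /=.
  by move/eqP; rewrite oner_eq0.
have Rbound l : R l -> (l <= `|na_b L - na_a L|)%N.
  move=> [j nz]; have : valid_path (na_a L) (na_b L) j l.
    by apply: contraT => /(pathm_out H)/eqP; rewrite (negbTE nz).
  by rewrite /valid_path; lia.
have [l [[j nz] Hl]] : exists l, R l /\ ~ R l.+1.
  apply: NNPP => Hn; have A l : R l.
    by elim: l => // l IHl; apply: NNPP => HR; apply: Hn; exists l.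
  by have := Rbound _ (A `|na_b L - na_a L|.+1); rewrite ltnn.
have mx j' : pathm X j' l.+1 = 0.
  by apply/eqP/negPn/negP => Hn; apply: Hl; exists j'.
have ret := itv_retract_max H nz mx.
have uv : j - l.+1%:Z < j by lia.
have vi := module_itv uv (retract_module ret H).
have [X' [isoX dX]] := retract_complement ret.
have rX' := retract_trans (retract_inr _ _) (iso_retract (iso_sym isoX)).
have /IH [] := retract_module rX' H.
  by rewrite -ltnS; apply: leq_trans le_n; rewrite ltnS -dX /=; lia.
move=> Is [HIs iI]; exists ((j - l.+1%:Z, j) :: Is); split.
  by move=> p; rewrite inE => /orP [/eqP ->|/HIs].
exact: iso_trans isoX (iso_dsum _ iI).
Qed.
End Decomposition.

(** * Ext groups: independence of the presentation, summands and direct sums *)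

Section Ext.
Local Open Scope ring_scope.
Variables (k : fieldType) (L : nakalg).
Implicit Types X Y Z E K P Q M N : rep k.
Implicit Types (u v w : int) (i : nat).

Definition cover K P X f g := [/\ is_module L K, projective L P & @ses k K P X f g].

Lemma itv_ses w u v : w <= u -> u <= v ->
  @ses k (itv k w u) (itv k w v) (itv k u v) (itv_map k w u w v) (itv_map k w v u v).
Proof.
move=> wu uv; have wv : w <= v by lia.
apply: (@split_ses _ _ _ _ _ _ (itv_map k w v w u) (itv_map k u v w v)).
- exact: itv_map_hom.
- exact: itv_map_hom.
- rewrite /itv_map /= shiftmxM // -shiftmx1 addr0; apply: shiftmx_eq => // s /=; rewrite !subr0; lia.
- rewrite /itv_map /= shiftmxM // -shiftmx1 addr0; apply: shiftmx_eq => // s /=; rewrite !subr0; lia.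
- rewrite /itv_map /= shiftmxM // addr0; apply: shiftmx0 => // s /=; rewrite !subr0; lia.
rewrite /itv_map /= !shiftmxM // addr0 shiftmxD //.
  rewrite -shiftmx1; apply: shiftmx_eq => // s /=; rewrite !subr0; lia.
by move=> s /=; rewrite !subr0; lia.
Qed.

Lemma itv_cover u v : valid_itv L u v ->
  @cover (itv k (low L v) u) (itv k (low L v) v) (itv k u v)
    (itv_map k (low L v) u (low L v) v) (itv_map k (low L v) v u v).
Proof.
move=> /and4P [au lu uv vb]; split; last exact: itv_ses.
  apply: itv_module; rewrite /valid_itv lu.
  by have := @low_mono L u v; have := @low_ge L v; lia.
by apply: itv_projective => //; lia.
Qed.

Lemma zero_projective : projective L (zero_rep k).
Proof.
split; first exact: zero_module.
move=> M N g h _ _ _ _ _; exists 0; split; first exact: hom0.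
by apply/matrixP; case.
Qed.

Lemma dsum_projective P Q : projective L P -> projective L Q -> projective L (dsum P Q).
Proof.
move=> [mP HP] [mQ HQ]; split; first exact: dsum_module.
move=> M N g h mM mN hg fg hh.
have [a [ha Ea]] := HP _ _ _ _ mM mN hg fg (homM (hom_dsum_inl P Q) hh).
have [b [hb Eb]] := HQ _ _ _ _ mM mN hg fg (homM (hom_dsum_inr P Q) hh).
exists (col_mx a b); split; first exact: hom_col_mx.
rewrite mul_col_mx Ea Eb -[h in RHS]vsubmxK -{1 2}[h]vsubmxK.
by rewrite row_mx_col_mx1 row_mx_col_mx2.
Qed.

Lemma zero_cover : cover (K := zero_rep k) (P := zero_rep k) (X := zero_rep k) 0 0.
Proof.
split; [exact: zero_module | exact: zero_projective | ].
by apply: (@split_ses _ _ _ _ _ _ 0 0); try exact: hom0; apply/matrixP; case.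
Qed.

Lemma dsum_cover K P X f g K' P' X' f' g' :
  @cover K P X f g -> @cover K' P' X' f' g' ->
  @cover (dsum K K') (dsum P P') (dsum X X') (block_mx f 0 0 f') (block_mx g 0 0 g').
Proof.
move=> [mK pP S] [mK' pP' S']; split; [exact: dsum_module | exact: dsum_projective | ].
have [a [b [H1 H2 H3 H4]]] := ses_split S; have [a' [b' [J1 J2 J3 J4]]] := ses_split S'.
have [hf _] := ses_mono S; have [hg _] := ses_epi S.
have [hf' _] := ses_mono S'; have [hg' _] := ses_epi S'.
apply: (@split_ses k (dsum K K') (dsum P P') (dsum X X') _ _ (block_mx a 0 0 a')
  (block_mx b 0 0 b')); try exact: hom_block.
all: rewrite !mulmx_block !mulmx0 !mul0mx !addr0 !add0r.
- by rewrite H1 J1 block_mx1.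
- by rewrite H2 J2 block_mx1.
- by rewrite H3 J3 /block_mx !row_mx0 col_mx0.
- by rewrite add_block_mx !addr0 H4 J4 block_mx1.
Qed.

Lemma iso_cover K P X Y f g : @cover K P X f g -> iso X Y -> exists g', @cover K P Y f g'.
Proof.
move=> [mK pP S] [s [p [hs hp E F]]]; exists (g *m s); split => //.
have [a [b [H1 H2 H3 H4]]] := ses_split S.
have [hf _] := ses_mono S; have [hg _] := ses_epi S.
apply: (@split_ses _ _ _ _ _ _ a (p *m b)) => //; first exact: homM.
- by rewrite -mulmxA (mulmxA b) H2 mul1mx.
- by rewrite mulmxA H3 mul0mx.
by rewrite -mulmxA (mulmxA s) E mul1mx.
Qed.

Lemma cover_exists X : is_module L X -> exists K P f g, @cover K P X f g.
Proof.
move=> /module_decomposition [Is [HIs iI]].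
have [K [P [f [g S]]]] :
  exists K P f g, @cover K P (dsum_list [seq itv k p.1 p.2 | p <- Is]) f g.
  elim: Is HIs {iI} => [|p Is IH] HIs /=.
    by exists (zero_rep k), (zero_rep k), 0, 0; exact: zero_cover.
  have [|K [P [f [g S]]]] := IH; first by move=> q Hq; apply: HIs; rewrite inE Hq orbT.
  have [_ vp] := HIs p (mem_head _ _); have C1 := itv_cover vp.
  by do 4 eexists; exact: dsum_cover C1 S.
by have [g' S'] := iso_cover S (iso_sym iI); exists K, P, f, g'.
Qed.

(** Surjectivity of Hom(P, Y) -> Hom(K, Y), whose cokernel is Ext^1(X, Y) for a presentation of X
    with syzygy K. *)
Definition extends K P (f : 'M[k]_(rdim K, rdim P)) Y :=
  forall h, @Hom k K Y h -> exists h', @Hom k P Y h' /\ f *m h' = h.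

Lemma cokernel K Z (w : 'M_(rdim K, rdim Z)) : @Hom k K Z w -> exists E (c : 'M[k]_(rdim Z, rdim E)) c',
  [/\ @Hom k Z E c, c' *m c = 1%:M, w *m c = 0 &
      forall m (x : 'M_(m, rdim Z)), x *m c = 0 -> exists y, x = y *m w].
Proof.
move=> hw.
have [d [c [fc wc kc]]] : exists d (c : 'M[k]_(rdim Z, d)), [/\ row_full c, w *m c = 0 &
    forall m (x : 'M_(m, rdim Z)), x *m c = 0 -> exists y, x = y *m w].
  exists (\rank (cokermx w)), (col_base (cokermx w)); split.
  - exact: col_base_full.
  - by apply: (free_cancel (row_base_free (cokermx w))); rewrite -mulmxA mulmx_base mulmx_coker mul0mx.
  move=> m x Hx; apply/submxP; rewrite submxE.
  by rewrite -(mulmx_base (cokermx w)) mulmxA Hx mul0mx.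
have [c' Hc] := row_fullP fc.
(* An endomorphism preserving the row space of [w] descends to the quotient, whatever the linear
   section [c']. *)
have stab (A : 'M_(rdim Z)) B : B *m w = w *m A -> c *m (c' *m A *m c) = A *m c.
  move=> HA; have [y Hy] : exists y, 1%:M - c *m c' = y *m w.
    by apply: kc; rewrite mulmxBl mul1mx -mulmxA Hc mulmx1 subrr.
  rewrite !mulmxA -[c *m c'](subKr 1%:M) Hy !mulmxBl mul1mx -(mulmxA y) -HA.
  by rewrite -!mulmxA wc !mulmx0 subr0.
pose E := @Rep k d (fun j => c' *m ridem Z j *m c) (fun j => c' *m rarr Z j *m c).
exists E, c, c'; split => //.
move=> i; case: (hw i) => a b; split; symmetry; first exact: stab a.
exact: stab b.
Qed.

(** Lift [g] to a map [b] into the extension; its restriction to K lands in Y and extends to P.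
    Subtracting the extension makes [b] vanish on K, and it descends to a splitting. *)
Lemma extends_ext1 K P X f g Y : @cover K P X f g -> is_module L X -> is_module L Y ->
  extends f Y -> ext0 L 0 X Y.
Proof.
move=> [mK [mP liftP] S] mX mY ext E f0 g0 mE SE.
have [hg fg] := ses_epi S; have [hg0 fg0] := ses_epi SE.
have [hf ff] := ses_mono S; have [hf0 ff0] := ses_mono SE.
have [b [hb Eb]] := liftP _ _ _ _ mE mX hg0 fg0 hg.
have fg0' : f *m g = 0 by have [? [? [_ _ -> _]]] := ses_split S.
have [|h [hh Eh]] := ses_factor_mono SE (homM hf hb).
  by rewrite -mulmxA Eb fg0'.
have [h' [hh' Eh']] := ext _ hh.
have [|s [hs Es]] := ses_factor_epi S (homB hb (homM hh' hf0)).
  by rewrite mulmxBr mulmxA Eh' Eh subrr.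
exists s; split => //; apply: (full_cancel fg).
rewrite mulmxA Es mulmxBl -(mulmxA h').
by have [? [? [_ _ -> _]]] := ses_split SE; rewrite mulmx0 subr0 mulmx1.
Qed.

(* The pushout of the projective cover along a map out of the syzygy. *)
Lemma ext1_extends K P X f g Y : @cover K P X f g -> is_module L X -> is_module L Y ->
  ext0 L 0 X Y -> extends f Y.
Proof.
move=> [mK [mP _] S] mX mY ext h hh.
have [f' [g' [H1 H2 H3 H4]]] := ses_split S.
have [hg fg] := ses_epi S; have [hf ff] := ses_mono S.
have hw : @Hom k K (dsum P Y) (row_mx f (- h)) by apply: hom_row_mx => //; apply: homN.
have [E [c [c' [hc Hc wc kc]]]] := cokernel hw.
have fc : row_full c by apply/row_fullP; exists c'.
have mE : is_module L E by apply: module_epi hc fc; apply: dsum_module.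
have hgc : @Hom k (dsum P Y) X (col_mx g 0) by apply: hom_col_mx => //; apply: hom0.
pose q := c' *m col_mx g 0; pose j := row_mx 0 1%:M *m c.
have cq : c *m q = col_mx g 0.
  rewrite /q mulmxA; have [|y Hy] := kc _ (1%:M - c *m c').
    by rewrite mulmxBl mul1mx -mulmxA Hc mulmx1 subrr.
  rewrite -[c *m c'](subKr 1%:M) Hy mulmxBl mul1mx -mulmxA mul_row_col H3.
  by rewrite mulmx0 addr0 mulmx0 subr0.
have hq : @Hom k E X q by apply: (hom_epi_factor hc fc); rewrite cq.
have hj : @Hom k Y E j by apply: homM hc; apply: hom_dsum_inr.
have jq : j *m q = 0 by rewrite /j -mulmxA cq mul_row_col mul0mx mulmx0 addr0.
have fq : row_full q.
  apply/row_fullP; exists (row_mx g' 0 *m c).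
  by rewrite -mulmxA cq mul_row_col H2 mul0mx addr0.
(* If a row (0, y) is a combination of the rows of (f, -h), the coefficients are killed by the
   injective [f]. *)
have fj : row_free j.
  rewrite -kermx_eq0; have := mulmx_ker j; move: (kermx j) => x.
  rewrite /j mulmxA mul_mx_row mulmx0 mulmx1 => /kc [y]; rewrite mul_mx_row => /eq_row_mx [].
  move=> /esym y0 ->.
  by rewrite (free_cancel ff (etrans y0 (esym (mul0mx _ f)))) mul0mx.
have SE : @ses k Y E X j q.
  split => //; split => //; split => //; split => //; apply/andP; split; first by apply/sub_kermxP.
  apply/submxP; have : kermx q *m q = 0 by apply: mulmx_ker.
  move: (kermx q) => x xq; have [|y Hy] := kc _ (1%:M - c *m c').
    by rewrite mulmxBl mul1mx -mulmxA Hc mulmx1 subrr.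
  pose z := x *m c'; have xz : x = z *m c by rewrite /z -mulmxA Hc mulmx1.
  move: xq; rewrite xz -mulmxA cq -[z]hsubmxK mul_row_col mulmx0 addr0 => lz.
  have [t Ht] : exists t, lsubmx z = t *m f.
    by exists (lsubmx z *m f'); rewrite -[LHS]mulmx1 -H4 mulmxDr !mulmxA lz mul0mx addr0.
  exists (rsubmx z + t *m h); rewrite /j mulmxA mul_mx_row mulmx0 mulmx1.
  have Ez : z = row_mx 0 (rsubmx z + t *m h) + t *m row_mx f (- h).
    by rewrite mul_mx_row add_row_mx add0r mulmxN addrK -Ht hsubmxK.
  by rewrite hsubmxK (congr1 (mulmx^~ c) Ez) mulmxDl -mulmxA wc mulmx0 addr0.
have [s [hs Es]] := ext _ _ _ mE SE.
have [|r [hr Er]] := ses_factor_mono SE (homB (hom1 E) (homM hq hs)).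
  by rewrite mulmxBl mul1mx -mulmxA Es mulmx1 subrr.
have jr : j *m r = 1%:M.
  by apply: (free_cancel fj); rewrite -mulmxA Er mulmxBr mulmx1 mulmxA jq mul0mx subr0 mul1mx.
exists (row_mx 1%:M 0 *m c *m r); split.
  by apply: homM hr; apply: homM hc; apply: hom_dsum_inl.
rewrite !mulmxA mul_mx_row mulmx1 mulmx0.
(* Modulo the relation [w], the image of K in P agrees with its image in Y under [h]. *)
have -> : row_mx f 0 = row_mx f (- h) + h *m row_mx 0 1%:M.
  by rewrite mul_mx_row mulmx0 mulmx1 add_row_mx addr0 addNr.
rewrite !mulmxDl wc mul0mx add0r.
have -> : h *m row_mx 0 1%:M *m c *m r = h *m (j *m r) by rewrite /j !mulmxA.
by rewrite jr mulmx1.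
Qed.

Lemma ext1_extendsE K P X f g Y : @cover K P X f g -> is_module L X -> is_module L Y ->
  ext0 L 0 X Y <-> extends f Y.
Proof. by move=> C mX mY; split; [apply: ext1_extends C _ _ | apply: extends_ext1 C _ _]. Qed.

(** Two presentations of one module have syzygies related only up to maps through projectives;
    ordinary retracts would not survive the passage to syzygies. *)
Definition stable_retract X X' := exists a b Q p q,
  [/\ @Hom k X X' a, @Hom k X' X b, projective L Q, @Hom k X Q p & @Hom k Q X q] /\
  a *m b = 1%:M + p *m q.

Lemma retract_stable X X' : retract X X' -> stable_retract X X'.
Proof.
move=> [s [p [hs hp E]]]; exists s, p, (zero_rep k), 0, 0; split; last by rewrite mulmx0 addr0.
by split => //; [exact: zero_projective | exact: hom0 | exact: hom0].
Qed.

Lemma stable_retract_syzygy K P X f g K' P' X' f' g' :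
  @cover K P X f g -> @cover K' P' X' f' g' -> is_module L X -> is_module L X' ->
  stable_retract X X' ->
  exists a b c d h, [/\ @Hom k P P' a, @Hom k P' P b, @Hom k K K' c, @Hom k K' K d & @Hom k P K h] /\
    [/\ c *m f' = f *m a, d *m f = f' *m b & c *m d = 1%:M + f *m h].
Proof.
move=> [mK [mP lP] S] [mK' [mP' lP'] S'] mX mX' [a [b [Q [p [q [[ha hb [mQ lQ] hp hq] ab]]]]]].
have [hg fg] := ses_epi S; have [hf ff] := ses_mono S.
have [hg' fg'] := ses_epi S'; have [hf' ff'] := ses_mono S'.
have fg0 : f *m g = 0 by have [? [? [_ _ -> _]]] := ses_split S.
have fg0' : f' *m g' = 0 by have [? [? [_ _ -> _]]] := ses_split S'.
have [A [hA EA]] := lP _ _ _ _ mP' mX' hg' fg' (homM hg ha).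
have [B [hB EB]] := lP' _ _ _ _ mP mX hg fg (homM hg' hb).
have [Q' [hQ EQ]] := lQ _ _ _ _ mP mX hg fg hq.
have [|c [hc Ec]] := ses_factor_mono S' (homM hf hA); first by rewrite -mulmxA EA mulmxA fg0 mul0mx.
have [|d [hd Ed]] := ses_factor_mono S (homM hf' hB); first by rewrite -mulmxA EB mulmxA fg0' mul0mx.
(* The lifts satisfy A B = 1 + g p Q' modulo maps into the kernel of [g]; [h] is that difference,
   and it becomes the error term f h on the syzygies. *)
have [|h [hh Eh]] := ses_factor_mono S (homB (homB (homM hA hB) (hom1 P)) (homM hg (homM hp hQ))).
  rewrite !mulmxBl mul1mx -(mulmxA A) EB (mulmxA A) EA -(mulmxA g a) ab -!mulmxA EQ mulmxDr.
  by rewrite mulmx1 addrAC addrK subrr.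
exists A, B, c, d, h; do 2!split => //.
apply: (free_cancel ff); rewrite -mulmxA Ed mulmxA Ec mulmxDl mul1mx -(mulmxA f h) Eh.
by rewrite !mulmxBr !mulmxA fg0 !mul0mx subr0 mulmx1 addrC subrK.
Qed.

(** Stable retracts pass to syzygies, so the induction on [i] closes. Both invariance under summands
    and independence of the presentation follow. *)
Lemma ext0_stable i X X' Y : is_module L X -> is_module L X' -> is_module L Y ->
  stable_retract X X' -> ext0 L i X' Y -> ext0 L i X Y.
Proof.
elim: i X X' => [|i IH] X X' mX mX' mY sXX.
  have [K [P [f [g S]]]] := cover_exists mX; have [K' [P' [f' [g' S']]]] := cover_exists mX'.
  rewrite (ext1_extendsE S' mX' mY) (ext1_extendsE S mX mY) => ext u hu.
  have [a [b [c [d [h [[ha hb hc hd hh] [Ec Ed cd]]]]]]] := stable_retract_syzygy S S' mX mX' sXX.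
  have [w [hw Ew]] := ext _ (homM hd hu).
  (* The term [h *m u] cancels the error [f *m h] in [c *m d]. *)
  exists (a *m w - h *m u); split; first by apply: homB; apply: homM.
  rewrite mulmxBr !mulmxA -Ec -(mulmxA c) Ew (mulmxA c) cd mulmxDl mul1mx.
  by rewrite addrK.
move=> [K' [P' [f' [g' [mK' [pP' [S' extK]]]]]]].
have [K [P [f [g S]]]] := cover_exists mX; have [mK pP SS] := S.
exists K, P, f, g; do 3!split => //; apply: (IH _ _ mK mK' mY _ extK).
have C' : @cover K' P' X' f' g' by [].
have [a [b [c [d [h [[ha hb hc hd hh] [Ec Ed cd]]]]]]] := stable_retract_syzygy S C' mX mX' sXX.
(* The error factors through the projective [P] itself. *)
by exists c, d, P, f, h; split => //; split => //; case: (ses_mono SS).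
Qed.

Lemma ext0_retractl i X X' Y : is_module L X -> is_module L X' -> is_module L Y ->
  retract X X' -> ext0 L i X' Y -> ext0 L i X Y.
Proof. by move=> mX mX' mY /retract_stable; apply: ext0_stable. Qed.

(** Any presentation computes [ext0], since the syzygies of two presentations are stable retracts of
    each other. *)
Lemma ext0_shift i K P X f g Y : @cover K P X f g -> is_module L X -> is_module L Y ->
  ext0 L i.+1 X Y <-> ext0 L i K Y.
Proof.
move=> C mX mY; have [mK pP S] := C; split; last by move=> H; exists K, P, f, g.
move=> [K' [P' [f' [g' [mK' [pP' [S' extK]]]]]]]; apply: (ext0_stable mK mK' mY _ extK).
have C' : @cover K' P' X f' g' by [].
have [a [b [c [d [h [[ha hb hc hd hh] [Ec Ed cd]]]]]]] :=
  stable_retract_syzygy C C' mX mX (retract_stable (retract_refl X)).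
by exists c, d, P, f, h; split => //; split => //; case: (ses_mono S).
Qed.

Lemma ext0_retractr i X Y Y' : is_module L X -> is_module L Y -> is_module L Y' ->
  retract Y Y' -> ext0 L i X Y' -> ext0 L i X Y.
Proof.
move=> + mY mY' R; elim: i X => [|i IH] X mX; have [K [P [f [g C]]]] := cover_exists mX.
  rewrite (ext1_extendsE C mX mY') (ext1_extendsE C mX mY) => ext h hh.
  have [s [p [hs hp sp]]] := R; have [h' [hh' Eh']] := ext _ (homM hh hs).
  exists (h' *m p); split; first exact: homM.
  by rewrite mulmxA Eh' -mulmxA sp mulmx1.
have [mK _ _] := C; rewrite (ext0_shift _ C mX mY) (ext0_shift _ C mX mY'); exact: IH.
Qed.

Lemma ext0_dsuml i X X' Y : is_module L X -> is_module L X' -> is_module L Y ->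
  ext0 L i X Y -> ext0 L i X' Y -> ext0 L i (dsum X X') Y.
Proof.
move=> + + mY; elim: i X X' => [|i IH] X X' mX mX'.
  have [K [P [f [g C]]]] := cover_exists mX; have [K' [P' [f' [g' C']]]] := cover_exists mX'.
  have mXX := dsum_module mX mX'.
  rewrite (ext1_extendsE C mX mY) (ext1_extendsE C' mX' mY) (ext1_extendsE (dsum_cover C C') mXX mY).
  move=> e e' h hh.
  have [a [ha Ea]] := e _ (homM (hom_dsum_inl K K') hh).
  have [b [hb Eb]] := e' _ (homM (hom_dsum_inr K K') hh).
  exists (col_mx a b); split; first exact: hom_col_mx.
  rewrite mul_block_col !mul0mx addr0 add0r Ea Eb -[h in RHS]vsubmxK -{1 2}[h]vsubmxK.
  by rewrite row_mx_col_mx1 row_mx_col_mx2.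
have [K [P [f [g C]]]] := cover_exists mX; have [K' [P' [f' [g' C']]]] := cover_exists mX'.
have mXX := dsum_module mX mX'.
rewrite (ext0_shift _ C mX mY) (ext0_shift _ C' mX' mY) (ext0_shift _ (dsum_cover C C') mXX mY).
by have [mK _ _] := C; have [mK' _ _] := C'; apply: IH.
Qed.

Lemma ext0_dsumr i X Y Y' : is_module L X -> is_module L Y -> is_module L Y' ->
  ext0 L i X Y -> ext0 L i X Y' -> ext0 L i X (dsum Y Y').
Proof.
move=> + mY mY'; have mYY := dsum_module mY mY'.
elim: i X => [|i IH] X mX; have [K [P [f [g C]]]] := cover_exists mX.
  rewrite (ext1_extendsE C mX mY) (ext1_extendsE C mX mY') (ext1_extendsE C mX mYY).
  move=> e e' h hh.
  have [a [ha Ea]] := e _ (homM hh (hom_dsum_prl Y Y')).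
  have [b [hb Eb]] := e' _ (homM hh (hom_dsum_prr Y Y')).
  exists (row_mx a b); split; first exact: hom_row_mx.
  rewrite mul_mx_row Ea Eb -[h in RHS]hsubmxK -{1 2}[h]hsubmxK.
  by rewrite !mul_row_col !mulmx0 !mulmx1 addr0 add0r.
have [mK _ _] := C.
rewrite (ext0_shift _ C mX mY) (ext0_shift _ C mX mY') (ext0_shift _ C mX mYY); exact: IH.
Qed.

Lemma ext0_zerol i Y : is_module L Y -> ext0 L i (zero_rep k) Y.
Proof.
move=> mY; have mz := zero_module k L; elim: i => [|i IH].
  rewrite (ext1_extendsE zero_cover mz mY) => h hh; exists h; split => //.
  by apply/matrixP; case.
by rewrite (ext0_shift _ zero_cover mz mY).
Qed.

Lemma ext0_zeror i X : is_module L X -> ext0 L i X (zero_rep k).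
Proof.
have mz := zero_module k L.
elim: i X => [|i IH] X mX; have [K [P [f [g C]]]] := cover_exists mX; have [mK _ _] := C.
  rewrite (ext1_extendsE C mX mz) => h hh; exists 0; split; first exact: hom0.
  by apply/matrixP => ? [].
by rewrite (ext0_shift _ C mX mz); apply: IH.
Qed.

Lemma ext0_dsum_listl i Xs Y : is_module L Y ->
  (forall X, List.In X Xs -> is_module L X /\ ext0 L i X Y) -> ext0 L i (dsum_list Xs) Y.
Proof.
move=> mY; elim: Xs => [|X Xs IH] H /=; first exact: ext0_zerol.
have [mX eX] := H X (or_introl erefl).
apply: ext0_dsuml => //; last by apply: IH => Z HZ; apply: H; right.
by apply: dsum_list_module => Z HZ; case: (H Z (or_intror HZ)).
Qed.

Lemma ext0_dsum_listr i X Ys : is_module L X ->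
  (forall Y, List.In Y Ys -> is_module L Y /\ ext0 L i X Y) -> ext0 L i X (dsum_list Ys).
Proof.
move=> mX; elim: Ys => [|Y Ys IH] H /=; first exact: ext0_zeror.
have [mY eY] := H Y (or_introl erefl).
apply: ext0_dsumr => //; last by apply: IH => Z HZ; apply: H; right.
by apply: dsum_list_module => Z HZ; case: (H Z (or_intror HZ)).
Qed.
End Ext.

(** * Cluster tilting as a condition on sets of intervals *)

Section Combinatorics.
Local Open Scope ring_scope.
Implicit Types (u v w A B : int) (i n : nat) (g : int -> int) (c : int -> int -> Prop).

(* Nonvanishing of Ext^(i+1) from ]u, v] to ]u', v'], the syzygy of ]u, v] being ]g v, u]. *)
Fixpoint ext_nz g i u v u' v' : bool :=
  if i is i'.+1 then ext_nz g i' (g v) u u' v' else [&& g v <= u', u' < u, u <= v' & v' < v].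

Definition indec A B g u v := [&& A <= u, g v <= u, u < v & v <= B].

(** The index [i] stands for degree i + 1. Functorial finiteness has no counterpart because it is
    automatic when there are finitely many intervals. *)
Definition comb_nZct n A B g c :=
  [/\ forall u v, indec A B g u v -> (c u v <-> forall i u' v', (i.+1 < n)%N ->
        indec A B g u' v' -> c u' v' -> ~~ ext_nz g i u' v' u v),
      forall u v, indec A B g u v -> (c u v <-> forall i u' v', (i.+1 < n)%N ->
        indec A B g u' v' -> c u' v' -> ~~ ext_nz g i u v u' v') &
      forall i u v u' v', indec A B g u v -> indec A B g u' v' -> c u v -> c u' v' ->
        ext_nz g i u v u' v' -> (n %| i.+1)%N].
End Combinatorics.

(** * Translation between subcategories of modules and sets of intervals *)

Section Translation.
Local Open Scope ring_scope.
Variables (k : fieldType) (L : nakalg).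
Implicit Types X Y Z E K P Q M N : rep k.
Implicit Types (u v w : int) (i n : nat).

(** A nonzero map from the syzygy ]g v, u] to ]u', v'] is a multiple of the canonical one and needs
    g v <= u' < u <= v'; it extends to the projective ]g v, v] exactly when v <= v'. *)
Lemma itv_ext0 i u v u' v' : valid_itv L u v -> valid_itv L u' v' ->
  ext0 L i (itv k u v) (itv k u' v') <-> ~~ ext_nz (low L) i u v u' v'.
Proof.
move=> V V'; have mN := itv_module k V'; have /and4P [_ _ uv' _] := V'.
elim: i u v V => [|i IH] u v V; have mM := itv_module k V; have C := itv_cover k V; last first.
  rewrite (ext0_shift _ C mM mN); apply: IH; move: V; rewrite /valid_itv => V.
  by have := @low_mono L u v; have := @low_ge L v; lia.
have /and4P [_ lu uv _] := V; have lv : low L v <= v by lia.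
rewrite (ext1_extendsE C mM mN); split=> [ext | nz h hh].
  apply/negP => /and4P [Ha Hb Hc Hd].
  have hm := itv_map_hom k lu uv' Ha Hc; have [h' [hh' E]] := ext _ hm.
  have lv1 : low L v < v by lia.
  case: (itv_hom_scal lv1 uv' hh') => [h0|[_ _ ?]]; last by lia.
  have := vtx_shift k u' v' u 0 predT lu; rewrite -/(itv_map k _ _ _ _) -E h0 !mulmx0.
  have -> : low L v < u <= u by lia.
  move/esym/eqP; rewrite subr0 (negbTE (vtx_neq0 _ _)) //; lia.
move: lu; rewrite le_eqVlt => /orP [/eqP lu|lu].
  exists 0; split; first exact: hom0.
  apply: (itv_hom_ext _ _ hh); rewrite ?lu // ?mulmx0; first exact: hom0.
  by rewrite vtx0 ?mul0mx // lu // ltxx.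
case: (itv_hom_scal lu uv' hh) => [->|[H1 H2 H3 [a Ea]]].
  by exists 0; split; [exact: hom0 | rewrite mulmx0].
have vv : v <= v' by move: nz; rewrite /= H1 H2 H3; lia.
exists (a *: itv_map k (low L v) v u' v'); split.
  by apply: homZ; apply: itv_map_hom.
rewrite Ea -scalemxAr; congr (_ *: _).
rewrite /itv_map shiftmxM // addr0; apply: shiftmx_eq => [||w] /=; rewrite ?subr0; lia.
Qed.

Lemma In_mapP T T' (F : T -> T') (s : seq T) y :
  List.In y [seq F x | x <- s] <-> exists x, List.In x s /\ y = F x.
Proof.
elim: s => [|x s IH] /=; first by split => // [[? []]].
split=> [[<-|/IH [z [Hz ->]]]|[z [[<-|Hz] Ey]]].
- by exists x; split => //; left.
- by exists z; split => //; right.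
- by left.
- by right; apply/IH; exists z.
Qed.

Lemma In_mem (T : eqType) (x : T) s : List.In x s <-> x \in s.
Proof.
elim: s => //= y s IH; rewrite inE; split=> [[->|/IH ->]|/orP [/eqP ->|/IH]]; rewrite ?eqxx ?orbT //.
  by left. by right.
Qed.

(** The predicate is not assumed decidable, so the sublist comes from excluded middle. *)
Lemma filter_Prop (T : eqType) (P : T -> Prop) (s : seq T) :
  exists s' : seq T, forall x, x \in s' <-> x \in s /\ P x.
Proof.
elim: s => [|y s [s' IH]]; first by exists [::] => x; split=> // [[]].
case: (classic (P y)) => Py.
  exists (y :: s') => x; rewrite !inE; split.
    by case/orP => [/eqP ->|/IH [-> ?]]; rewrite ?eqxx ?orbT.
  by case=> /orP [->//|xs] Px; apply/orP; right; apply/IH.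
exists s' => x; rewrite inE IH; split=> [[-> ?]|[/orP [/eqP ->|->] ?]] //.
by rewrite orbT.
Qed.

Lemma valid_itv_enum : exists s : seq (int * int), forall p, valid_itv L p.1 p.2 -> p \in s.
Proof.
pose r := [seq na_a L - 1 + i%:Z | i <- iota 0 `|(na_b L - na_a L + 2)%R|].
exists [seq (x, y) | x <- r, y <- r] => -[u v] /= V.
have inr x : na_a L - 1 <= x <= na_b L -> x \in r.
  move=> Hx; apply/mapP; exists `|(x - (na_a L - 1))%R|%N; last by lia.
  by rewrite mem_iota; lia.
by apply/allpairsP; exists (u, v); split => //=; apply: inr; move: V; rewrite /valid_itv; lia.
Qed.

(** Retracts instead of isomorphic copies: closure under direct summands is built in. *)
Definition sum_of_itvs (c : int -> int -> Prop) X := is_module L X /\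
  exists Is : seq (int * int), (forall p, p \in Is -> p.1 < p.2 /\ valid_itv L p.1 p.2 /\ c p.1 p.2) /\
  retract X (dsum_list [seq itv k p.1 p.2 | p <- Is]).

Lemma decomposition_retract X : is_module L X -> exists Is : seq (int * int),
  (forall p, p \in Is -> [/\ p.1 < p.2, valid_itv L p.1 p.2 & retract (itv k p.1 p.2) X]) /\
  retract X (dsum_list [seq itv k p.1 p.2 | p <- Is]).
Proof.
move=> /module_decomposition [Is [HIs iI]]; exists Is; split; last exact: iso_retract iI.
move=> p Hp; have [pv Vp] := HIs p Hp; split => //.
apply: retract_trans (iso_retract (iso_sym iI)); apply: retract_inseq.
by apply/In_mapP; exists p; split => //; apply/In_mem.
Qed.

Section ClusterTilting.
Variables (n : nat) (C : rep k -> Prop).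
Hypothesis CT : n_cluster_tilting n L C.

Lemma nct_module X : C X -> is_module L X.
Proof. by case: CT => H _; apply: H. Qed.

Lemma nct_Ext X Y i : C X -> C Y -> (i.+1 < n)%N -> ext0 L i X Y.
Proof.
move=> CX CY Hi; have mX := nct_module CX; case: CT => _ [_ [_ /(_ X mX) [/(_ CX i.+1)]]].
by rewrite ltn0Sn Hi => /(_ isT Y CY).
Qed.

Lemma nctl X : is_module L X -> (forall Z i, C Z -> (i.+1 < n)%N -> ext0 L i Z X) -> C X.
Proof.
move=> mX H; case: CT => _ [_ [/(_ X mX) [_ H'] _]]; apply: H' => -[|i] // Hi Z CZ.
exact: H.
Qed.

Lemma nctr X : is_module L X -> (forall Z i, C Z -> (i.+1 < n)%N -> ext0 L i X Z) -> C X.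
Proof.
move=> mX H; case: CT => _ [_ [_ /(_ X mX) [_ H']]]; apply: H' => -[|i] // Hi Z CZ.
exact: H.
Qed.

Lemma nct_retract X Y : retract X Y -> C Y -> C X.
Proof.
move=> R CY; have mY := nct_module CY; have mX := retract_module R mY.
apply: nctr => // Z i CZ Hi; apply: (ext0_retractl mX mY (nct_module CZ) R).
exact: nct_Ext.
Qed.

Lemma nct_dsum_list Ys : (forall Y, List.In Y Ys -> C Y) -> C (dsum_list Ys).
Proof.
move=> H; apply: nctr; first by apply: dsum_list_module => Y /H /nct_module.
move=> Z i CZ Hi; apply: ext0_dsum_listl; first exact: nct_module.
by move=> Y /H CY; split; [apply: nct_module | apply: nct_Ext].
Qed.

Lemma nct_itvs X : C X <-> sum_of_itvs (fun u v => C (itv k u v)) X.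
Proof.
split=> [CX | [mX [Is [HIs R]]]].
  have mX := nct_module CX; split => //; have [Is [HIs R]] := decomposition_retract mX.
  exists Is; split => // p /HIs [pv Vp Rp]; do 2!split => //; exact: nct_retract Rp CX.
apply: (nct_retract R); apply: nct_dsum_list => Y /In_mapP [p [/In_mem Hp ->]].
by case: (HIs p Hp) => _ [].
Qed.

Lemma indec_valid u v : indec (na_a L - 1) (na_b L) (low L) u v = (u < v) && valid_itv L u v.
Proof. rewrite /indec /valid_itv; lia. Qed.

Lemma nct_extl u v : valid_itv L u v -> (forall i u' v', (i.+1 < n)%N ->
    indec (na_a L - 1) (na_b L) (low L) u' v' -> C (itv k u' v') -> ~~ ext_nz (low L) i u' v' u v) ->
  C (itv k u v).
Proof.
move=> V H; have mX := itv_module k V; apply: nctl => // Z i CZ Hi.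
have mZ := nct_module CZ; have /nct_itvs [_ [Is [HIs R]]] := CZ.
have HI Y : List.In Y [seq itv k p.1 p.2 | p <- Is] -> is_module L Y /\ ext0 L i Y (itv k u v).
  move=> /In_mapP [p [/In_mem /HIs [pv [Vp Cp]] ->]]; split; first exact: itv_module.
  by apply/itv_ext0 => //; apply: H => //; rewrite indec_valid pv.
apply: (ext0_retractl mZ _ mX R); first by apply: dsum_list_module => Y /HI [].
exact: ext0_dsum_listl.
Qed.

Lemma nct_extr u v : valid_itv L u v -> (forall i u' v', (i.+1 < n)%N ->
    indec (na_a L - 1) (na_b L) (low L) u' v' -> C (itv k u' v') -> ~~ ext_nz (low L) i u v u' v') ->
  C (itv k u v).
Proof.
move=> V H; have mX := itv_module k V; apply: nctr => // Z i CZ Hi.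
have mZ := nct_module CZ; have /nct_itvs [_ [Is [HIs R]]] := CZ.
have HI Y : List.In Y [seq itv k p.1 p.2 | p <- Is] -> is_module L Y /\ ext0 L i (itv k u v) Y.
  move=> /In_mapP [p [/In_mem /HIs [pv [Vp Cp]] ->]]; split; first exact: itv_module.
  by apply/itv_ext0 => //; apply: H => //; rewrite indec_valid pv.
apply: (ext0_retractr mX mZ _ R); first by apply: dsum_list_module => Y /HI [].
exact: ext0_dsum_listr.
Qed.
End ClusterTilting.

Lemma nZct_comb n C : nZ_cluster_tilting n L C ->
  comb_nZct n (na_a L - 1) (na_b L) (low L) (fun u v => C (itv k u v)).
Proof.
move=> [CT nZ]; split=> [u v|u v|i u v u' v'].
- rewrite indec_valid => /andP [uv V]; split; last exact: nct_extl.
  move=> Cu i u' v' Hi; rewrite indec_valid => /andP [uv' V'] Cu'.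
  by apply/itv_ext0 => //; apply: (nct_Ext CT).
- rewrite indec_valid => /andP [uv V]; split; last exact: nct_extr.
  move=> Cu i u' v' Hi; rewrite indec_valid => /andP [uv' V'] Cu'.
  by apply/itv_ext0 => //; apply: (nct_Ext CT).
rewrite !indec_valid => /andP [uv V] /andP [uv' V'] Cu Cu' nz.
apply: (nZ i.+1 _ _ _ Cu Cu') => //; rewrite /Ext_vanish /=.
by move/itv_ext0 => /(_ V V'); rewrite nz.
Qed.

(** With [p] and [q] abstract, one proof serves Hom(M, X) and Hom(X, M). Generation is stated as an
    induction principle for [Q], the form in which it is used to factor maps. *)
Lemma finite_generators (p q : rep k -> nat) (H : forall M, 'M[k]_(p M, q M) -> Prop) Ms :
  (forall M a f f', H M f -> H M f' -> H M (a *: f + f')) ->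
  exists S : seq {M : rep k & 'M[k]_(p M, q M)},
    (forall s, List.In s S -> H (tag s) (tagged s) /\ List.In (tag s) Ms) /\
    forall M h, List.In M Ms -> H M h -> forall Q : 'M[k]_(p M, q M) -> Prop, Q 0 ->
      (forall a f f', Q f -> Q f' -> Q (a *: f + f')) ->
      (forall f, List.In (Tagged (fun M => 'M[k]_(p M, q M)) f) S -> Q f) -> Q h.
Proof.
move=> Hlin; elim: Ms => [|M Ms [S [HS gen]]]; first by exists [::].
have [fs [Hfs span]] : exists fs : seq 'M[k]_(p M, q M),
    (forall f, f \in fs -> H M f) /\ forall h, H M h -> h \in <<fs>>%VS.
  apply: NNPP => nfs.
  (* Without a finite spanning family, independent families of every size would exist, against the
     finite dimension of the matrix space. *)
  have A m : exists fs : seq 'M[k]_(p M, q M), [/\ size fs = m, free fs & forall f, f \in fs -> H M f].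
    elim: m => [|m [fs [sz fr Hf]]]; first by exists [::]; split => //; rewrite nil_free.
    have [h [Hh nh]] : exists h, H M h /\ h \notin <<fs>>%VS.
      apply: NNPP => nh; apply: nfs; exists fs; split => // h Hh.
      by apply/negPn/negP => Hn; apply: nh; exists h.
    exists (h :: fs); split; [by rewrite /= sz | by rewrite free_cons nh | ].
    by move=> f; rewrite inE => /orP [/eqP ->|/Hf].
  have [fs [sz fr _]] := A (\dim {: 'M[k]_(p M, q M)}).+1.
  by have := dimvS (subvf <<fs>>); rewrite (eqP fr) sz ltnn.
exists ([seq Tagged (fun M => 'M[k]_(p M, q M)) f | f <- fs] ++ S); split.
  move=> s /(List.in_app_or _ _ _) [/In_mapP [f [/In_mem Hf ->]]|/HS [H1 H2]] /=.
    by split; [apply: Hfs | left].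
  by split => //; right.
move=> N + HN; case: HN => [<-|HN] h Hh Q Q0 Qlin HQ; last first.
  by apply: (gen N h HN Hh Q Q0 Qlin) => f Hf; apply: HQ; apply: List.in_or_app; right.
have -> := coord_span (X := in_tuple fs) (span h Hh).
elim/big_rec: _ => // i x _ Qx; apply: Qlin => //; apply: HQ; apply: List.in_or_app; left.
by apply/In_mapP; exists fs`_i; split => //; apply/In_mem; rewrite mem_nth.
Qed.

Lemma hom_lin X Y a f f' : @Hom k X Y f -> @Hom k X Y f' -> @Hom k X Y (a *: f + f').
Proof. by move=> hf hf'; apply: homD => //; apply: homZ. Qed.

Lemma right_approximation Ms X : exists Zs (f : 'M[k]_(rdim (dsum_list Zs), rdim X)),
  (forall Z, List.In Z Zs -> List.In Z Ms) /\ Hom f /\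
  forall Ys h, (forall Y, List.In Y Ys -> List.In Y Ms) -> @Hom k (dsum_list Ys) X h ->
    exists h', @Hom k (dsum_list Ys) (dsum_list Zs) h' /\ h' *m f = h.
Proof.
have [S [HS gen]] := @finite_generators (@rdim k) (fun _ => rdim X) (fun M f => @Hom k M X f) Ms
  (fun M => @hom_lin M X).
(* [F] adds up all generating maps, with one copy of the source for each; other maps factor through
   it by linearity. *)
have [F [hF facF]] : exists F : 'M[k]_(rdim (dsum_list [seq tag s | s <- S]), rdim X), Hom F /\
    forall s, List.In s S -> exists h', @Hom k (tag s) _ h' /\ h' *m F = tagged s.
  elim: S HS {gen} => [|s S IH] HS; first by exists 0; split; first exact: hom0.
  have [|F [hF fac]] := IH; first by move=> t Ht; apply: HS; right.
  have [hs _] := HS s (or_introl erefl).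
  exists (col_mx (tagged s) F); split; first exact: hom_col_mx.
  move=> t [<-|/fac [h' [hh' Eh']]].
    by exists (row_mx 1%:M 0); split; [exact: hom_dsum_inl | rewrite row_mx_col_mx1].
  exists (h' *m row_mx 0 1%:M); split; first by apply: homM hh' _; exact: hom_dsum_inr.
  by rewrite -mulmxA row_mx_col_mx2.
exists [seq tag s | s <- S], F; split; first by move=> Z /In_mapP [s [/HS [_ ?] ->]].
split => // Ys; elim: Ys => [|Y Ys IH] h HY hh.
  by exists 0; split; [exact: hom0 | apply/matrixP; case].
have [a [ha Ea]] : exists a, @Hom k Y (dsum_list [seq tag s | s <- S]) a /\ a *m F = row_mx 1%:M 0 *m h.
  apply: (gen Y (row_mx 1%:M 0 *m h) (HY Y (or_introl erefl)) (homM (hom_dsum_inl _ _) hh)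
    (fun x => exists a, @Hom k Y (dsum_list [seq tag s | s <- S]) a /\ a *m F = x)).
  - by exists 0; split; [exact: hom0 | rewrite mul0mx].
  - move=> x f f' [a [ha <-]] [a' [ha' <-]]; exists (x *: a + a'); split; first exact: hom_lin.
    by rewrite mulmxDl scalemxAl.
  by move=> f /facF.
have [b [hb Eb]] := IH (row_mx 0 1%:M *m h) (fun Z HZ => HY Z (or_intror HZ))
  (homM (hom_dsum_inr _ _) hh).
exists (col_mx a b); split; first exact: hom_col_mx.
by rewrite mul_col_mx Ea Eb -mul_col_mx -[col_mx (row_mx _ _) _]/(block_mx _ _ _ _) block_mx1 mul1mx.
Qed.

Lemma left_approximation Ms X : exists Zs (f : 'M[k]_(rdim X, rdim (dsum_list Zs))),
  (forall Z, List.In Z Zs -> List.In Z Ms) /\ Hom f /\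
  forall Ys h, (forall Y, List.In Y Ys -> List.In Y Ms) -> @Hom k X (dsum_list Ys) h ->
    exists h', @Hom k (dsum_list Zs) (dsum_list Ys) h' /\ f *m h' = h.
Proof.
have [S [HS gen]] := @finite_generators (fun _ => rdim X) (@rdim k) (fun M f => @Hom k X M f) Ms
  (fun M => @hom_lin X M).
have [F [hF facF]] : exists F : 'M[k]_(rdim X, rdim (dsum_list [seq tag s | s <- S])), Hom F /\
    forall s, List.In s S -> exists h', @Hom k _ (tag s) h' /\ F *m h' = tagged s.
  elim: S HS {gen} => [|s S IH] HS; first by exists 0; split; first exact: hom0.
  have [|F [hF fac]] := IH; first by move=> t Ht; apply: HS; right.
  have [hs _] := HS s (or_introl erefl).
  exists (row_mx (tagged s) F); split; first exact: hom_row_mx.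
  move=> t [<-|/fac [h' [hh' Eh']]].
    exists (col_mx 1%:M 0); split; first exact: hom_dsum_prl.
    by rewrite mul_row_col mulmx1 mulmx0 addr0.
  exists (col_mx 0 1%:M *m h'); split; first by apply: homM _ hh'; exact: hom_dsum_prr.
  by rewrite mulmxA mul_row_col mulmx1 mulmx0 add0r.
exists [seq tag s | s <- S], F; split; first by move=> Z /In_mapP [s [/HS [_ ?] ->]].
split => // Ys; elim: Ys => [|Y Ys IH] h HY hh.
  by exists 0; split; [exact: hom0 | apply/matrixP => ? []].
have [a [ha Ea]] : exists a, @Hom k (dsum_list [seq tag s | s <- S]) Y a /\ F *m a = h *m col_mx 1%:M 0.
  apply: (gen Y (h *m col_mx 1%:M 0) (HY Y (or_introl erefl)) (homM hh (hom_dsum_prl _ _))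
    (fun x => exists a, @Hom k (dsum_list [seq tag s | s <- S]) Y a /\ F *m a = x)).
  - by exists 0; split; [exact: hom0 | rewrite mulmx0].
  - move=> x f f' [a [ha <-]] [a' [ha' <-]]; exists (x *: a + a'); split; first exact: hom_lin.
    by rewrite mulmxDr scalemxAr.
  by move=> f /facF.
have [b [hb Eb]] := IH (h *m col_mx 0 1%:M) (fun Z HZ => HY Z (or_intror HZ))
  (homM hh (hom_dsum_prr _ _)).
exists (row_mx a b); split; first exact: hom_row_mx.
by rewrite mul_mx_row Ea Eb -mul_mx_row -block_mxEh block_mx1 mulmx1.
Qed.

Lemma comb_nZct_exists n c : comb_nZct n (na_a L - 1) (na_b L) (low L) c ->
  nZ_cluster_tilting n L (sum_of_itvs c).
Proof.
move=> [N1 N2 N3].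
have itvC u v : u < v -> valid_itv L u v -> c u v -> sum_of_itvs c (itv k u v).
  move=> uv V cu; split; first exact: itv_module.
  by exists [:: (u, v)]; split; [move=> p /[!inE] /eqP -> | exact: retract_inl].
have ext_sum i X Y : (forall u v u' v', u < v -> valid_itv L u v -> c u v -> 
    u' < v' -> valid_itv L u' v' -> c u' v' -> ~~ ext_nz (low L) i u v u' v') ->
    sum_of_itvs c X -> sum_of_itvs c Y -> ext0 L i X Y.
  move=> H [mX [Is [HIs R]]] [mY [Js [HJs R']]].
  have mIs : is_module L (dsum_list [seq itv k p.1 p.2 | p <- Is]).
    by apply: dsum_list_module => _ /In_mapP [p [/In_mem /HIs [_ [V _]] ->]]; apply: itv_module.
  have mJs : is_module L (dsum_list [seq itv k p.1 p.2 | p <- Js]).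
    by apply: dsum_list_module => _ /In_mapP [p [/In_mem /HJs [_ [V _]] ->]]; apply: itv_module.
  apply: (ext0_retractl mX mIs mY R); apply: (ext0_retractr mIs mY mJs R').
  apply: ext0_dsum_listl => // _ /In_mapP [p [/In_mem /HIs [pv [V cp]] ->]].
  have mp := itv_module k V; split => //; apply: ext0_dsum_listr => //.
  move=> _ /In_mapP [q [/In_mem /HJs [qv [V' cq]] ->]]; split; first exact: itv_module.
  by apply/itv_ext0 => //; apply: H.
have small i X Y : (i.+1 < n)%N -> sum_of_itvs c X -> sum_of_itvs c Y -> ext0 L i X Y.
  move=> Hi; apply: ext_sum => u v u' v' uv V cu uv' V' cu'.
  by have [|/(_ cu) H _] := N2 u v; [rewrite indec_valid uv | apply: H; rewrite // indec_valid uv'].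
(* Only finitely many intervals are valid, so those in [c] form a finite list [Ms], which yields the
   approximations. *)
have [all_itv Hall] := valid_itv_enum.
have [Is HIs] := filter_Prop (fun p => (p.1 < p.2 /\ valid_itv L p.1 p.2 /\ c p.1 p.2)) all_itv.
pose Ms := [seq itv k p.1 p.2 | p <- Is].
have sumMs Zs : (forall Z, List.In Z Zs -> List.In Z Ms) -> sum_of_itvs c (dsum_list Zs).
  elim: Zs => [|Z Zs IH] HZ.
    by split; [exact: zero_module | exists [::]; split => //; exact: retract_refl].
  have [mZ [Js [HJs R]]] := IH (fun Y HY => HZ Y (or_intror HY)).
  have /In_mapP [p [/In_mem/HIs [_ Hp] ->]] := HZ Z (or_introl erefl).
  split; first by apply: dsum_module => //; apply: itv_module; case: Hp => _ [].
  exists (p :: Js); split; last exact: retract_dsum (retract_refl _) R.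
  by move=> q; rewrite inE => /orP [/eqP ->|/HJs].
have inMs Z : sum_of_itvs c Z ->
    exists Zs, (forall Y, List.In Y Zs -> List.In Y Ms) /\ retract Z (dsum_list Zs).
  move=> [mZ [Js [HJs R]]]; exists [seq itv k p.1 p.2 | p <- Js]; split => //.
  move=> _ /In_mapP [p [/In_mem Hp ->]]; apply/In_mapP; exists p; split => //; apply/In_mem/HIs.
  by have := HJs p Hp; split => //; apply: Hall; case: H => _ [].
split; [split; [|split; [split|split]]|].
- by move=> X [].
- move=> X mX; have [Zs [f [HZs [hf fac]]]] := right_approximation Ms X.
  exists (dsum_list Zs), f; split; first exact: sumMs; split => // Z' h.
  move=> /inMs [Ys [HYs [s [p [hs hp sp]]]]] hh; have [h' [hh' Eh']] := fac Ys _ HYs (homM hp hh).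
  exists (s *m h'); split; first exact: homM.
  by rewrite -mulmxA Eh' mulmxA sp mul1mx.
- move=> X mX; have [Zs [f [HZs [hf fac]]]] := left_approximation Ms X.
  exists (dsum_list Zs), f; split; first exact: sumMs; split => // Z' h.
  move=> /inMs [Ys [HYs [s [p [hs hp sp]]]]] hh; have [h' [hh' Eh']] := fac Ys _ HYs (homM hh hs).
  exists (h' *m p); split; first exact: homM.
  by rewrite mulmxA Eh' -mulmxA sp mulmx1.
- move=> X mX; split=> [CX [|i] // Hi Z CZ|H]; first exact: small.
  split => //; have [Js [HJs R]] := decomposition_retract mX.
  exists Js; split => // p Hp; have [pv V Rp] := HJs p Hp; do 2!split => //.
  apply/N1; first by rewrite indec_valid pv.
  move=> i u' v' Hi; rewrite indec_valid => /andP [uv' V'] cu'.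
  apply/(itv_ext0 i V' V); apply: (ext0_retractr _ _ mX Rp); try exact: itv_module.
  by apply: (H i.+1) => //; apply: itvC.
- move=> X mX; split=> [CX [|i] // Hi Z CZ|H]; first exact: small.
  split => //; have [Js [HJs R]] := decomposition_retract mX.
  exists Js; split => // p Hp; have [pv V Rp] := HJs p Hp; do 2!split => //.
  apply/N2; first by rewrite indec_valid pv.
  move=> i u' v' Hi; rewrite indec_valid => /andP [uv' V'] cu'.
  apply/(itv_ext0 i V V'); apply: (ext0_retractl _ mX _ Rp); try exact: itv_module.
  by apply: (H i.+1) => //; apply: itvC.
move=> [|i] // _ Z W CZ CW nE; apply: contraT => ndiv; case: nE.
apply: ext_sum CZ CW => u v u' v' uv V cu uv' V' cu'.
apply: contraNN ndiv; apply: (N3 i u v u' v') => //; by rewrite indec_valid ?uv ?uv'.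
Qed.
End Translation.

(** * Homological algebra of intervals: duality and closure under shifted syzygies *)

Section Bounds.
Local Open Scope ring_scope.
Implicit Types (u v w x a b A B : int) (i j m n : nat) (g f : int -> int) (c : int -> int -> Prop).

(** The name refers to g v <= v; the function [g] itself is monotone. *)
Definition decreasing_bound A B g :=
  (forall v, A <= v <= B -> A <= g v <= v) /\
  (forall v w, A <= v -> v <= w -> w <= B -> g v <= g w).

Lemma ext_nz_lt A B g i u v u' v' : decreasing_bound A B g ->
  A <= u -> g v <= u -> u <= v -> v <= B -> ext_nz g i u v u' v' -> u' < u /\ v' < v.
Proof.
move=> [gb gm]; elim: i u v => [|i IH] u v Au gu uv vB /=; first by lia.
move=> H; have Gv := gb v; have Gu := gm u v.
by have [||||| ? ?] := IH (g v) u; try exact: H; lia.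
Qed.

(** For factors of a gluing: their bounds agree with that of the whole algebra only on their own
    vertices, and their sets only on their own intervals. *)
Lemma comb_nZct_congr n A B g g' c c' : decreasing_bound A B g ->
  (forall v, A <= v <= B -> g v = g' v) ->
  (forall u v, indec A B g u v -> (c u v <-> c' u v)) ->
  comb_nZct n A B g c -> comb_nZct n A B g' c'.
Proof.
move=> gb gg cc.
have iE u v : indec A B g' u v = indec A B g u v.
  by rewrite /indec; have := gg v; lia.
have eE i u v u' v' : A <= u -> u <= v -> v <= B -> g v <= u ->
    ext_nz g' i u v u' v' = ext_nz g i u v u' v'.
  elim: i u v => [|i IH] u v Au uv vB gu /=; rewrite -gg; try by lia.
  by case: gb => gb gm; apply: IH; have := gb v; have := gm u v; lia.
have eI i u v u' v' : indec A B g u v -> ext_nz g' i u v u' v' = ext_nz g i u v u' v'.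
  by move=> /and4P [? ? ? ?]; apply: eE => //; lia.
move=> [N1 N2 N3]; split.
- move=> u v; rewrite iE => I; rewrite -(cc u v I) (N1 u v I); split=> H i u' v' Hi.
    by rewrite iE => I'; rewrite -(cc u' v' I') (eI _ _ _ _ _ I'); apply: H.
  by move=> I'; rewrite (cc u' v' I') -(eI _ _ _ _ _ I'); apply: H; rewrite // iE.
- move=> u v; rewrite iE => I; rewrite -(cc u v I) (N2 u v I); split=> H i u' v' Hi.
    by rewrite iE => I'; rewrite -(cc u' v' I') (eI _ _ _ _ _ I); apply: H.
  by move=> I'; rewrite (cc u' v' I') -(eI _ _ _ _ _ I); apply: H; rewrite // iE.
move=> i u v u' v'; rewrite !iE => I I'; rewrite -(cc u v I) -(cc u' v' I') eI //.
exact: N3.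
Qed.

(** Induct on B - u: nonzero Ext into ]u, v] comes only from intervals with larger lower end, where
    membership is already decided. *)
Lemma comb_nZct_unique n A B g c c' : decreasing_bound A B g ->
  comb_nZct n A B g c -> comb_nZct n A B g c' ->
  forall u v, indec A B g u v -> (c u v <-> c' u v).
Proof.
move=> gb [N1 _ _] [N1' _ _] u v.
have [m] := ubnP `|(B - u)%R|; elim: m u v => // m IH u v um I.
rewrite (N1 u v I) (N1' u v I); split=> H i u' v' Hi I' Cu'; apply/negP => E.
all: have /and4P [? ? ? ?] := I'; have [||||lu _] := ext_nz_lt gb _ _ _ _ E; try by lia.
all: by move: E; apply/negP; apply: H => //; apply/(IH u' v') => //; lia.
Qed.

(* f u is the top of the injective envelope of the simple module at u + 1. *)
Record galois_bound A B g f := GaloisBound {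
  gal_g : forall v, A <= v <= B -> A <= g v <= v;
  gal_f : forall u, A <= u <= B -> u <= f u <= B;
  gal : forall u v, A <= u <= B -> A <= v <= B -> (g v <= u) = (v <= f u)
}.

Lemma galois_mono A B g f : galois_bound A B g f -> decreasing_bound A B g.
Proof.
move=> H; split; first exact: gal_g H.
move=> v w Av vw wB; have Hw := gal_g H (v := w); have Hv := gal_g H (v := v).
have gw : A <= g w <= B by lia.
have := gal H gw (v := w); have := gal H gw (v := v); lia.
Qed.

Lemma galois_monof A B g f u v : galois_bound A B g f ->
  A <= u -> u <= v -> v <= B -> f u <= f v.
Proof.
move=> H Au uv vB; have Hu := gal_f H (u := u); have Hv := gal_f H (u := v).
have := gal H (u := u) (v := f u); have := gal H (u := v) (v := f u); lia.
Qed.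

(** Negation models vector space duality to the opposite algebra: ]u, v] becomes ]-v, -u], and
    projectives and injectives are exchanged. *)
Lemma galois_dual A B g f : galois_bound A B g f ->
  galois_bound (- B) (- A) (fun v => - f (- v)) (fun v => - g (- v)).
Proof.
move=> H; split.
- by move=> v Hv; have := gal_f H (u := - v); lia.
- by move=> v Hv; have := gal_g H (v := - v); lia.
move=> u v Hu Hv; have := gal H (u := - v) (v := - u); lia.
Qed.

(** Dimension shift in the second argument: ]u', v'] has injective envelope ]u', f u'], hence
    cosyzygy ]v', f u']. *)
Lemma ext_nz_shift A B g f i u v u' v' : galois_bound A B g f ->
  A <= u -> g v <= u -> u <= v -> v <= B -> A <= u' -> g v' <= u' -> u' <= v' -> v' <= B ->
  ext_nz g i.+1 u v u' v' = ext_nz g i u v v' (f u').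
Proof.
move=> H Au gu uv vB Au' gu' uv' vB'; have [_ gm] := galois_mono H.
elim: i u v Au gu uv vB => [|i IH] u v Au gu uv vB.
  rewrite /=; have gv : A <= g v <= v by apply: (gal_g H); lia.
  have := gal H (u := u') (v := u); have := gal H (u := u') (v := v); lia.
rewrite [RHS]/= -IH //; have := gal_g H (v := v); have := gm u v; lia.
Qed.

Lemma ext_nz_dual A B g f i u v u' v' : galois_bound A B g f ->
  A <= u -> g v <= u -> u <= v -> v <= B -> A <= u' -> g v' <= u' -> u' <= v' -> v' <= B ->
  ext_nz (fun w => - f (- w)) i (- v') (- u') (- v) (- u) = ext_nz g i u v u' v'.
Proof.
move=> H Au gu uv vB; elim: i u' v' => [|i IH] u' v' Au' gu' uv' vB'.
  by rewrite /= !opprK; have := gal H (u := u') (v := v); lia.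
rewrite (ext_nz_shift _ H) // -IH //; last first.
- by have := gal_f H (u := u'); lia.
- by have := gal H (u := u') (v := v'); lia.
- by have := gal H (u := u') (v := f u'); have := gal_f H (u := u'); lia.
- by lia.
by rewrite /= !opprK.
Qed.

Lemma indec_dual A B g f u v : galois_bound A B g f ->
  indec (- B) (- A) (fun w => - f (- w)) u v = indec A B g (- v) (- u).
Proof. by move=> H; rewrite /indec; have := gal H (u := - v) (v := - u); lia. Qed.

Lemma comb_nZct_dual n A B g f c : galois_bound A B g f -> comb_nZct n A B g c ->
  comb_nZct n (- B) (- A) (fun w => - f (- w)) (fun u v => c (- v) (- u)).
Proof.
move=> H [N1 N2 N3].
have eE i u v u' v' : indec A B g (- v) (- u) -> indec A B g (- v') (- u') ->
    ext_nz (fun w => - f (- w)) i u v u' v' = ext_nz g i (- v') (- u') (- v) (- u).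
  move=> /and4P [? ? ? ?] /and4P [? ? ? ?]; rewrite -(ext_nz_dual _ H) //; try by lia.
  by rewrite !opprK.
have iE u v := indec_dual u v H.
split.
- move=> u v; rewrite iE => I; rewrite (N2 _ _ I); split=> H' i u' v' Hi.
    by rewrite iE => I' cu'; rewrite eE //; apply: H'.
  move=> I' cu'; have := H' i (- v') (- u') Hi; rewrite iE !opprK => /(_ I' cu').
  by rewrite eE ?opprK.
- move=> u v; rewrite iE => I; rewrite (N1 _ _ I); split=> H' i u' v' Hi.
    by rewrite iE => I' cu'; rewrite eE //; apply: H'.
  move=> I' cu'; have := H' i (- v') (- u') Hi; rewrite iE !opprK => /(_ I' cu').
  by rewrite eE ?opprK.
move=> i u v u' v'; rewrite !iE => I I' cu cu'; rewrite eE //; exact: N3.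
Qed.

(** The two claims need each other: the formal syzygy of the zero interval ]v, v] is the projective
    ]g v, v], whose syzygy is the zero interval ]g v, g v]. *)
Lemma ext_nz_proj g i v u' v' :
  (ext_nz g i v v u' v' = false) * (ext_nz g i (g v) v u' v' = false).
Proof.
elim: i v => [|i IH] v; first by split=> /=; lia.
by split; rewrite /= IH.
Qed.

Lemma ext_nz_inj A B g f i u v u' : galois_bound A B g f ->
  A <= u -> g v <= u -> u <= v -> v <= B -> A <= u' <= B -> ext_nz g i u v u' (f u') = false.
Proof.
move=> H; elim: i u v => [|i IH] u v Au gu uv vB Hu' /=.
  by have := gal H (u := u') (v := v); lia.
have [gb gm] := galois_mono H; apply: IH => //; have := gb v; have := gm u v; lia.
Qed.

Lemma comb_proj n A B g c v : comb_nZct n A B g c -> indec A B g (g v) v -> c (g v) v.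
Proof. by move=> [_ N2 _] I; apply/N2 => // i u' v' _ _ _; rewrite ext_nz_proj. Qed.

Lemma comb_inj n A B g f c u : galois_bound A B g f -> comb_nZct n A B g c ->
  indec A B g u (f u) -> c u (f u).
Proof.
move=> H [N1 _ _] I; apply/N1 => // i u' v' _ /and4P [? ? ? ?] _.
by case/and4P: I => ? ? ? ?; rewrite (ext_nz_inj _ H) //; lia.
Qed.

(** If g (v - 1) = g v, the projective with top S_(v-1), which is in [c], receives a nonzero Ext^1
    from the nonprojective ]u, v]. *)
Lemma comb_top_jump n A B g f c u v : galois_bound A B g f -> comb_nZct n A B g c ->
  (1 < n)%N -> indec A B g u v -> c u v -> g v < u -> g (v - 1) < g v.
Proof.
move=> H N Hn I cu gu; have [gb gm] := galois_mono H; case/and4P: (I) => Au _ uv vB.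
have := gb (v - 1); have := gm (v - 1) v; case: ltgtP => // E Hm Hb; first by lia.
have I' : indec A B g (g (v - 1)) (v - 1) by apply/and4P; split; lia.
case: (N) => _ N2 _; have /(N2 u v I) := cu.
move=> /(_ 0%N (g (v - 1)) (v - 1) Hn I' (comb_proj N I')) /=; lia.
Qed.

(* The object K_(n-1) = tau^- Omega^-(n-1) of the n-cluster tilting set has Omega^n K_(n-1) equal to
   the interval of the conclusion; here K_k = (s_k + 1, s_(k+1) + 1) for the coresolution s of
   ]u, v], so that Omega K_(k+1) = K_k. *)
Lemma comb_shift_syzygy n A B g f c u v : galois_bound A B g f -> comb_nZct n A B g c ->
  (1 < n)%N -> indec A B g u v -> c u v -> v < B -> g (v + 1) <= u -> c (g (v + 1)) (u + 1).
Proof.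
move=> H N Hn I cu vB gu; have dm := galois_mono H; have [gb gm] := dm.
have [N1 N2 N3] := N; have /(N1 u v I) NM := cu.
(* [M k] is the k-th cosyzygy of ]u, v], that is, the pair (s_k, s_(k+1)). *)
have [M [M0 ME]] : exists M : nat -> int * int,
    M 0%N = (u, v) /\ forall k, M k.+1 = ((M k).2, f (M k).1).
  by exists (fun k => iter k (fun p => (p.2, f p.1)) (u, v)).
have shiftM i u' v' k : indec A B g u' v' -> (forall j, (j < k)%N ->
      indec A B g (M j).1 (M j).2) ->
    ext_nz g i u' v' (M k).1 (M k).2 = ext_nz g (i + k) u' v' u v.
  move=> /and4P [? ? ? ?]; elim: k i => [|k IH] i HI; first by rewrite M0 addn0.
  rewrite ME /= -(ext_nz_shift _ H) //; try by (have /and4P [? ? ? ?] := HI k (ltnSn _); lia).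
  by rewrite IH ?addSnnS // => j jk; apply: HI; rewrite ltnS ltnW.
(* Up to k = n - 1 no cosyzygy is injective, and [f] jumps strictly after each earlier s_j. *)
have St k : (k < n)%N -> (forall j, (j <= k)%N -> indec A B g (M j).1 (M j).2) /\
    (M k).2 < f (M k).1 /\ (forall j, (j < k)%N -> f (M j).1 < f ((M j).1 + 1)).
  elim: k => [_|k IH kn].
    split; first by move=> [|j] // _; rewrite M0.
    split => //; case/and4P: I => ? ? ? ?; have := gal H (u := u) (v := v + 1); rewrite M0 /=; lia.
  have [Ij [lf Hj]] := IH (ltnW kn); have /and4P [Ax gx xy yB] := Ij k (leqnn k).
  move: (lf) (Ax) (gx) (xy) (yB); case EM : (M k) => [x y] /= lf' Ax' gx' xy' yB'.
  have fx := gal_f H (u := x); have fm := galois_monof H (u := x) (v := x + 1).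
  have gfx := gal H (u := x) (v := f x).
  (* Otherwise the injective ]x + 1, f x], which is in [c], would have nonzero Ext^1 to [M k], hence
     nonzero Ext^(k+1) to ]u, v]. *)
  have jump : f x < f (x + 1).
    case: ltgtP => // E; first by lia.
    have II : indec A B g (x + 1) (f (x + 1)) by rewrite -E; apply/and4P; split; lia.
    have := NM k _ _ kn II (comb_inj H N II).
    rewrite -[k in ext_nz g k]add0n -shiftM //; last by move=> j jk; apply: Ij; exact: ltnW.
    by rewrite EM /= -E; lia.
  have fm' := galois_monof H (u := x + 1) (v := y).
  split; [|split].
  - move=> j; rewrite leq_eqVlt => /orP [/eqP ->|]; last by rewrite ltnS; apply: Ij.
    by rewrite ME EM /=; apply/and4P; split; lia.
  - by rewrite ME EM /=; lia.
  by move=> j; rewrite ltnS leq_eqVlt => /orP [/eqP -> | /Hj //]; rewrite EM.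
have [m En] : exists m, n = m.+2 by exists n.-2; lia.
have [IM [_ jump]] : (forall j, (j <= m.+1)%N -> indec A B g (M j).1 (M j).2) /\
    (M m.+1).2 < f (M m.+1).1 /\ (forall j, (j < m.+1)%N -> f (M j).1 < f ((M j).1 + 1)).
  by apply: St; rewrite En.
(* The jump of [f] at s_j makes s_j + 1 the bound at f s_j + 1; this is the identity Omega K_(j+1) =
   K_j. *)
have top_shift j : (j <= m)%N -> g ((M j.+1).2 + 1) = (M j).1 + 1.
  move=> jm; have := jump j jm; have := IM j; rewrite ME /=; move: (M j).1 (M j).2 => x y.
  move=> /(_ (leqW jm)) /and4P [? ? ? ?] fj.
  have fx := gal_f H (u := x); have fx1 := gal_f H (u := x + 1).
  have := gal H (u := x) (v := f x + 1); have := gal H (u := x + 1) (v := f x + 1); lia.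
pose K j i u' v' := ext_nz g i ((M j).1 + 1) ((M j).2 + 1) u' v'.
have KS j i u' v' : (j <= m)%N -> K j.+1 i.+1 u' v' = K j i u' v'.
  by move=> jm; rewrite /K /= top_shift // ME.
have Kadd j i u' v' : (j <= m.+1)%N -> K j (i + j)%N u' v' = K 0%N i u' v'.
  by elim: j i => [|j IH] i jm; rewrite ?addn0 // addnS KS // IH // ltnW.
(* Descend to degree 1, then apply Auslander-Reiten duality: nonzero Ext^1 from K_(j+1) to Y gives
   nonzero Ext^1 from Y to [M j], hence Ext^(j+1) from Y to ]u, v]. *)
have Ksmall j i u' v' : indec A B g u' v' -> (i < j)%N -> (j <= m.+1)%N -> K j i u' v' ->
    ext_nz g (j - i.+1) u' v' u v.
  move=> I'; elim: i j => [|i IH] [|j] // ij jm; last first.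
    by rewrite KS // subSS; apply: IH => //; exact: ltnW.
  rewrite /K /= top_shift // subn1 /= -[j in ext_nz g j]add0n -shiftM //; last first.
    by move=> l lj; apply: IM; lia.
  have /and4P [? ? ? ?] := IM j (leqW jm); case/and4P: I' => ? ? ? ? /=.
  by rewrite ME /=; have := gal H (u := (M j).1) (v := v'); lia.
have IK : indec A B g ((M m.+1).1 + 1) ((M m.+1).2 + 1).
  have := top_shift m (leqnn m); have := jump m (ltnSn m); have := IM m (leqW (leqnn m)).
  have := IM m.+1 (leqnn _); rewrite !ME /=; move: (M m).1 (M m).2 => x y.
  move=> /and4P [? ? ? ?] /and4P [? ? ? ?] ? gfx; have := gal_f H (u := x + 1).
  by move=> ?; apply/and4P; split; lia.
(* Degrees below n out of K_(n-1) become degrees below n into ]u, v], where Ext from [c]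
   vanishes. *)
have cK : c ((M m.+1).1 + 1) ((M m.+1).2 + 1).
  apply/(N2 _ _ IK) => i u' v' Hi I' cu'; apply/negP => E.
  have im : (i < m.+1)%N by rewrite -ltnS -En.
  have := Ksmall _ _ _ _ I' im (leqnn _) E; apply/negP; apply: NM => //.
  by rewrite En; lia.
have Iphi : indec A B g (g (v + 1)) (u + 1).
  case/and4P: I => ? ? ? ?; have := gb (v + 1); have := gm (u + 1) (v + 1).
  by move=> ? ?; apply/and4P; split; lia.
apply/(N2 _ _ Iphi) => i u' v' Hi I' cu'; apply/negP => E.
(* Degree i + 1 out of Omega^n K_(n-1) is degree n + i + 1 out of K_(n-1); by the nZ condition n
   would divide i + 1 < n. *)
have : K m.+1 (i.+1 + m.+1)%N u' v' by rewrite Kadd // /K M0 /=.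
move/(N3 _ _ _ _ _ IK I' cK cu').
have -> : (i.+1 + m.+1).+1 = (n + i.+1)%N by rewrite En; lia.
by rewrite dvdn_addr // => /dvdn_leq; lia.
Qed.

Lemma comb_shift_cosyzygy n A B g f c u v : galois_bound A B g f -> comb_nZct n A B g c ->
  (1 < n)%N -> indec A B g u v -> c u v -> A < u -> g v < u -> c (v - 1) (f (u - 1)).
Proof.
move=> H N Hn I cu Au gu.
have I' : indec (- B) (- A) (fun w => - f (- w)) (- v) (- u) by rewrite (indec_dual _ _ H) !opprK.
have := comb_shift_syzygy (galois_dual H) (comb_nZct_dual H N) Hn I'; rewrite /= !opprK.
have -> : - (- u + 1) = u - 1 by lia.
have -> : - (- v + 1) = v - 1 by lia.
apply=> //; first by lia.
by case/and4P: I => ? ? ? ?; have := gal H (u := u - 1) (v := v); lia.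
Qed.
End Bounds.

(** * Simple modules in [c] and the homogeneous case *)

Section Cuts.
Local Open Scope ring_scope.
Implicit Types (u v w x a b A B : int) (i j m n : nat) (g f : int -> int) (c : int -> int -> Prop).

(** The first vertex is A + 1 and its projective is simple; from the next one on, g v <= v - 2 says
    that no arrow lies in the ideal. *)
Definition admissible_bound A g B := (forall v, A < v <= B -> g v < v) /\
  (forall v, A + 1 < v <= B -> g v <= v - 2).

Section CutVertices.
Variables (n : nat) (A B : int) (g f : int -> int) (c : int -> int -> Prop).
Hypotheses (H : galois_bound A B g f) (N : comb_nZct n A B g c) (Hn : (1 < n)%N).
Hypothesis (adm : admissible_bound A g B).

(* If p = g (x + 1) < x - 1, then two applications of the shifted syzygy produce the simple
   module at p + 1 < x, and the argument repeats. *)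
Lemma simple_cut x : A + 1 < x < B -> c (x - 1) x -> g (x + 1) = x - 1.
Proof.
have [gb gm] := galois_mono H; have [adm1 adm2] := adm.
have [m] := ubnP `|(x - A)%R|; elim: m x => // m IH x xm Hx cx.
have I : indec A B g (x - 1) x by have := adm2 x; rewrite /indec; lia.
have gx := adm2 (x + 1); have gx0 := adm2 x; case: (ltgtP (g (x + 1)) (x - 1)) => // E; last by lia.
set p := g (x + 1) in E *.
(* This gives p >= g x > g (x - 1) >= A, so p + 1 lies in the range of the induction hypothesis. *)
have jx : g (x - 1) < g x by apply: (comb_top_jump H N Hn I cx); lia.
have pgx : g x <= p by apply: gm; lia.
have Ap : A < p by have := gb (x - 1); lia.
have c1 : c p x.
  by have := comb_shift_syzygy H N Hn I cx; rewrite subrK; apply; rewrite -/p; lia.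
have I1 : indec A B g p x by rewrite /indec; lia.
have c2 : c p (p + 1) by apply: (comb_shift_syzygy H N Hn I1 c1); rewrite -/p; lia.
have c2' : c (p + 1 - 1) (p + 1) by rewrite addrK.
have gp : g (p + 2) = p.
  have := IH (p + 1); rewrite addrK; have -> : p + 1 + 1 = p + 2 by lia.
  by apply => //; lia.
(* In the first case p = g (p + 2) <= g (x - 1) < g x <= p. In the second g x = p, and the simple
   module at x has nonzero Ext^1 to the one at p + 1. *)
have [px|px] : p + 2 <= x - 1 \/ p + 2 = x by lia.
  by have := gm (p + 2) (x - 1); lia.
have [_ N2 _] := N; have /(N2 _ _ I) := cx.
move=> /(_ 0%N p (p + 1) Hn) /=; have I2 : indec A B g p (p + 1).
  by have := adm1 (p + 1); rewrite /indec; lia.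
by move=> /(_ I2 c2); rewrite -px gp; lia.
Qed.

(** The jump makes ]g v + 1, v] injective and not projective; the dual closure sends it to ]v - 1, f
    (g v)], where f (g v) = v. *)
Lemma simple_of_jump v : A + 1 < v -> v < B -> g v + 2 <= g (v + 1) -> c (v - 1) v.
Proof.
move=> Av vB gv; have [gb gm] := galois_mono H; have [adm1 adm2] := adm.
have Hv := gb v; have gv2 := adm2 v; have gv3 := adm1 (v + 1).
have fv : f (g v + 1) = v.
  have := gal_f H (u := g v + 1); have := gal H (u := g v + 1) (v := v).
  have := gal H (u := g v + 1) (v := v + 1); lia.
have I : indec A B g (g v + 1) (f (g v + 1)) by rewrite fv /indec; lia.
have := comb_inj H N I; rewrite fv => ci.
have I' : indec A B g (g v + 1) v by rewrite -{2}fv.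
have := comb_shift_cosyzygy H N Hn I' ci; rewrite addrK.
have -> : f (g v) = v.
  have := galois_monof H (u := g v) (v := g v + 1); have := gal H (u := g v) (v := v); lia.
by apply; lia.
Qed.

(** The closure sends the projective ]g v, v] to ]g (v + 1), g v + 1], which is simple when the
    value repeats. *)
Lemma simple_of_fiber v : A < v -> v < B -> g (v + 1) = g v -> c (g v) (g v + 1).
Proof.
move=> Av vB gv; have [gb gm] := galois_mono H; have [adm1 adm2] := adm.
have I : indec A B g (g v) v by have := gb v; have := adm1 v; rewrite /indec; lia.
by have := comb_shift_syzygy H N Hn I (comb_proj N I) vB; rewrite gv; apply.
Qed.

Lemma no_cut_homogeneous : A + 1 < B -> (forall x, A + 1 < x < B -> ~ c (x - 1) x) ->
  exists l, (2 <= l)%N /\ forall v, A <= v <= B -> g v = Num.max A (v - l%:Z).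
Proof.
move=> AB nocut; have [gb gm] := galois_mono H; have [adm1 adm2] := adm.
have fA := gal_f H (u := A); have fA2 := gal H (u := A) (v := A + 2); have gA2 := adm2 (A + 2).
(* [f A] is the last vertex with bound A. Beyond it the bound must rise by exactly 1 at each step,
   since any other step yields an interior simple module in [c]. *)
exists `|(f A - A)%R|%N; split; first by lia.
have low v : A <= v <= f A -> g v = A.
  by move=> Hv; have := gal H (u := A) (v := v); have := gb v; lia.
have high j : f A + 1 + j%:Z <= B -> g (f A + 1 + j%:Z) = A + 1 + j%:Z.
  have step v : f A <= v < B -> g v <= g (v + 1) <= g v + 1.
    move=> Hv; have := gm v (v + 1); case: (lerP (g v + 2) (g (v + 1))) => [gv|]; last by lia.
    by case: (nocut v); [lia | apply: simple_of_jump gv; lia].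
  have strict v : f A < v < B -> g (v + 1) != g v.
    move=> Hv; apply/eqP => gv; have Av : A < v by lia.
    have gA : A < g v by have := gal H (u := A) (v := v); lia.
    have vB : v < B by lia.
    have := simple_of_fiber Av vB gv; have := adm2 v; move=> ? ?.
    by case: (nocut (g v + 1)); [lia | rewrite addrK].
  elim: j => [|j IH] Hj.
    have := step (f A); have := low (f A); have := gal H (u := A) (v := f A + 1).
    by rewrite addr0; lia.
  have := step (f A + 1 + j%:Z); have := strict (f A + 1 + j%:Z).
  have -> : f A + 1 + j%:Z + 1 = f A + 1 + j.+1%:Z by lia.
  by rewrite IH; lia.
move=> v Hv; case: (lerP v (f A)) => fv.
  by rewrite low; lia.
have := high `|(v - f A - 1)%R|%N; have -> : f A + 1 + `|(v - f A - 1)%R|%N%:Z = v by lia.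
by lia.
Qed.
End CutVertices.

(* The bound of the upper factor of an algebra cut at the vertex x; its vertices are x, ..., B. *)
Definition upper_bound g x v : int := if v <= x then x - 1 else g v.

(** * Cutting and gluing at a vertex *)

Section Glue.
Variables (n : nat) (A B x : int) (g : int -> int) (c : int -> int -> Prop).
Hypotheses (dg : decreasing_bound A B g) (strict : forall v, A < v <= B -> g v < v).
Hypotheses (Hx : A + 1 < x < B) (cut : g (x + 1) = x - 1).

Let h := upper_bound g x.

Lemma upper_decreasing : decreasing_bound (x - 1) B h.
Proof.
have [gb gm] := dg; split; rewrite /h /upper_bound.
  by move=> v Hv; have := gm (x + 1) v; have := gb v; case: (lerP v x); lia.
move=> v w xv vw wB; case: (lerP v x) => ?; case: (lerP w x) => ? //.
all: by have := gm (x + 1) w; have := gm v w; lia.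
Qed.

Lemma indec_lower u v : indec A x g u v = indec A B g u v && (v <= x).
Proof. by rewrite /indec; lia. Qed.

Lemma indec_upper u v : indec (x - 1) B h u v = indec A B g u v && (x - 1 <= u).
Proof.
rewrite /indec /h /upper_bound; have := strict (v := x); have [gb gm] := dg.
by have := gm v x; case: (lerP v x); lia.
Qed.

(** The path x + 1 -> x -> x - 1 is zero, so no interval contains all three vertices. *)
Lemma indec_cut u v : indec A B g u v -> v <= x \/ (x < v /\ x - 1 <= u).
Proof.
move=> /and4P [? ? ? ?]; have [gb gm] := dg; have := gm (x + 1) v; lia.
Qed.

(** The bounds differ only for v <= x. There both sides vanish: a nonzero Ext strictly lowers both
    ends, which leaves no interval above x - 1. *)
Lemma ext_nz_upper i u v u' v' : x - 1 <= u -> g v <= u -> u <= v -> v <= B -> x - 1 <= u' -> u' < v' ->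
  ext_nz h i u v u' v' = ext_nz g i u v u' v'.
Proof.
move=> xu gu uv vB xu' uv'; have du := upper_decreasing; have [gb gm] := dg.
elim: i u v xu gu uv vB => [|i IH] u v xu gu uv vB.
  by rewrite /= /h /upper_bound; case: (lerP v x) => // vx; lia.
case: (lerP v x) => vx.
  have hv : h v = x - 1 by rewrite /h /upper_bound vx.
  transitivity false; [|symmetry]; apply/negP => E.
    by have [|||| ? ?] := ext_nz_lt du _ _ _ _ E; lia.
  by have [|||| ? ?] := ext_nz_lt dg _ _ _ _ E; lia.
have hv : h v = g v by rewrite /h /upper_bound ifN // -ltNge.
rewrite /= hv; have := gm (x + 1) v; have := gm u v; have := gb v => ? ? ?.
by apply: IH; lia.
Qed.

(** Follow the syzygies down: the resolution can cross the cut only by having the simple module at x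
    as a syzygy. The degrees add: (j + 1) + (i - j) = i + 1. *)
Lemma ext_nz_cut i u v u' v' : x < v -> g v <= u -> u < v -> v <= B ->
  u' < x - 1 -> v' <= x -> u' < v' ->
  ext_nz g i u v u' v' -> exists j, [/\ (j < i)%N, ext_nz g j u v (x - 1) x &
    ext_nz g (i - j.+1) (x - 1) x u' v'].
Proof.
move=> xv gu uv vB xu' xv' uv'; have [gb gm] := dg.
elim: i u v xv gu uv vB => [|i IH] u v xv gu uv vB /= E.
  by have := gm (x + 1) v; lia.
have gv : x - 1 <= g v by have := gm (x + 1) v; lia.
case: (lerP u x) => xu.
  have [ug|ug] : u = g v \/ (g v = x - 1 /\ u = x) by lia.
    by move: E; rewrite ug ext_nz_proj.
  (* Here the first syzygy ]g v, u] is itself ]x - 1, x]. *)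
  exists 0%N; split => //=; first by lia.
  by rewrite subn1 /= -{1}(proj1 ug) -(proj2 ug).
have guv := gm u v; have gub := gb v.
have [gu_lt|gu_eq] : g v < u \/ g v = u by lia.
  by have [j [? ? ?]] : exists j, [/\ (j < i)%N, ext_nz g j (g v) u (x - 1) x &
    ext_nz g (i - j.+1) (x - 1) x u' v'] by [apply: (IH (g v) u) E; lia]; exists j.+1.
by move: E; rewrite gu_eq ext_nz_proj.
Qed.

Hypothesis cx : c (x - 1) x.

(** Inside a factor this is the hypothesis on that factor. Nothing goes upwards across the cut, and
    downwards the degree is a sum of two multiples of n. *)
Lemma glue_ext i u v u' v' :
  comb_nZct n A x g c -> comb_nZct n (x - 1) B h c -> indec A B g u v -> indec A B g u' v' ->
  c u v -> c u' v' -> ext_nz g i u v u' v' -> (n %| i.+1)%N.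
Proof.
move=> [_ _ N3] [_ _ M3] I I' cu cu' E; have [gb gm] := dg.
have Ix : indec A B g (x - 1) x by have := strict (v := x); rewrite /indec; lia.
have /and4P [? ? ? ?] := I; have /and4P [? ? ? ?] := I'.
have lt : u' < u /\ v' < v by apply: (ext_nz_lt dg _ _ _ _ E); lia.
case: (indec_cut I) => [vx|[vx ux]].
  by apply: (N3 i u v u' v') => //; rewrite indec_lower ?I ?I' //; lia.
case: (lerP (x - 1) u') => xu'.
  apply: (M3 i u v u' v') => //; rewrite ?indec_upper ?I ?I' //.
  by rewrite ext_nz_upper //; lia.
have v'x : v' <= x by case: (indec_cut I') => // -[]; lia.
have [j [ji E1 E2]] : exists j, [/\ (j < i)%N, ext_nz g j u v (x - 1) x &
    ext_nz g (i - j.+1) (x - 1) x u' v'] by apply: ext_nz_cut E; lia.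
have d1 : (n %| j.+1)%N.
  apply: (M3 j u v (x - 1) x) => //; rewrite ?indec_upper ?I ?Ix ?lexx //.
  by rewrite ext_nz_upper //; lia.
have d2 : (n %| (i - j.+1).+1)%N.
  by apply: (N3 _ (x - 1) x u' v') => //; rewrite indec_lower ?Ix ?I' ?lexx.
have -> : i.+1 = (j.+1 + (i - j.+1).+1)%N by lia.
by rewrite dvdn_add.
Qed.

Lemma comb_nZct_glue : comb_nZct n A x g c -> comb_nZct n (x - 1) B h c -> comb_nZct n A B g c.
Proof.
move=> N M; have key i u v u' v' := @glue_ext i u v u' v' N M.
have nd i : (i.+1 < n)%N -> (n %| i.+1)%N = false.
  by move=> Hi; apply/negP => /dvdn_leq; lia.
have [N1 N2 N3] := N; have [M1 M2 M3] := M.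
split=> [u v I|u v I|]; last by move=> i u v u' v' I I' cu cu'; apply: key.
- split=> [cu i u' v' Hi I' cu'|E]; first by apply/negP => /(key _ _ _ _ _ I' I cu' cu); rewrite nd.
  case: (indec_cut I) => [vx|[vx ux]].
    apply/N1; first by rewrite indec_lower I.
    by move=> i u' v' Hi; rewrite indec_lower => /andP [I' _]; apply: E.
  apply/M1; first by rewrite indec_upper I.
  move=> i u' v' Hi; rewrite indec_upper => /andP [I' ux'] cu'.
  by case/and4P: (I) (I') => ? ? ? ? /and4P [? ? ? ?]; rewrite ext_nz_upper; try lia; apply: E.
split=> [cu i u' v' Hi I' cu'|E]; first by apply/negP => /(key _ _ _ _ _ I I' cu cu'); rewrite nd.
case: (indec_cut I) => [vx|[vx ux]].
  apply/N2; first by rewrite indec_lower I.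
  by move=> i u' v' Hi; rewrite indec_lower => /andP [I' _]; apply: E.
apply/M2; first by rewrite indec_upper I.
move=> i u' v' Hi; rewrite indec_upper => /andP [I' ux'] cu'.
by case/and4P: (I) (I') => ? ? ? ? /and4P [? ? ? ?]; rewrite ext_nz_upper; try lia; apply: E.
Qed.

(** Tests across the cut add nothing: a nonzero Ext across it in degree below n would give one of
    smaller degree into the simple module at x, which is in [c]. *)
Lemma comb_nZct_split : comb_nZct n A B g c -> comb_nZct n A x g c /\ comb_nZct n (x - 1) B h c.
Proof.
move=> [N1 N2 N3]; have [gb gm] := dg.
have nd i : (i.+1 < n)%N -> (n %| i.+1)%N = false.
  by move=> Hi; apply/negP => /dvdn_leq; lia.
have Ix : indec A B g (x - 1) x by have := strict (v := x); rewrite /indec; lia.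
have cutE i u v u' v' : indec A B g u v -> indec A B g u' v' -> x < v -> u' < x - 1 -> c u v ->
    (i.+1 < n)%N -> ext_nz g i u v u' v' -> False.
  move=> I I' xv xu' cu Hi E; have v'x : v' <= x by case: (indec_cut I') => // -[]; lia.
  have /and4P [? ? ? ?] := I; have /and4P [? ? ? ?] := I'.
  have [j [ji E1 _]] : exists j, [/\ (j < i)%N, ext_nz g j u v (x - 1) x &
    ext_nz g (i - j.+1) (x - 1) x u' v'] by apply: ext_nz_cut E; lia.
  by have := N3 _ _ _ _ _ I Ix cu cx E1; rewrite nd //; lia.
(* An interval belonging to both factors can only be ]x - 1, x]. *)
have simple u v : indec A B g u v -> v <= x -> x - 1 <= u -> c u v.
  by move=> /and4P [? ? ? ?] ? ?; have [-> ->] : u = x - 1 /\ v = x by lia.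
split; split.
- move=> u v; rewrite indec_lower => /andP [I vx]; split=> [cu i u' v' Hi|E].
    by rewrite indec_lower => /andP [I' _] cu'; have /(N1 u v I) H := cu; apply: H.
  case: (lerP (x - 1) u) => xu; first exact: simple.
  apply/N1 => // i u' v' Hi I' cu'; case: (lerP v' x) => xv'.
    by apply: E => //; rewrite indec_lower I'.
  by apply/negP; apply: cutE.
- move=> u v; rewrite indec_lower => /andP [I vx]; split=> [cu i u' v' Hi|E].
    by rewrite indec_lower => /andP [I' _] cu'; have /(N2 u v I) H := cu; apply: H.
  apply/N2 => // i u' v' Hi I' cu'; apply/negP => E'; have /and4P [? ? ? ?] := I.
  have [|||| _ ?] := ext_nz_lt dg _ _ _ _ E'; try by lia.
  by move: E'; apply/negP; apply: E => //; rewrite indec_lower I'; lia.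
- by move=> i u v u' v'; rewrite !indec_lower => /andP [I _] /andP [I' _]; apply: N3.
- move=> u v; rewrite indec_upper => /andP [I ux]; split=> [cu i u' v' Hi|E].
    rewrite indec_upper => /andP [I' ux'] cu'; case/and4P: (I) (I') => ? ? ? ? /and4P [? ? ? ?].
    by rewrite ext_nz_upper; try lia; have /(N1 u v I) H := cu; apply: H.
  apply/N1 => // i u' v' Hi I' cu'; case/and4P: (I) (I') => ? ? ? ? /and4P [? ? ? ?].
  case: (lerP (x - 1) u') => xu'.
    by rewrite -ext_nz_upper; try lia; apply: E => //; rewrite indec_upper I'.
  apply/negP => E'; have [|||| ? ?] := ext_nz_lt dg _ _ _ _ E'; by lia.
- move=> u v; rewrite indec_upper => /andP [I ux]; split=> [cu i u' v' Hi|E].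
    rewrite indec_upper => /andP [I' ux'] cu'; case/and4P: (I) (I') => ? ? ? ? /and4P [? ? ? ?].
    by rewrite ext_nz_upper; try lia; have /(N2 u v I) H := cu; apply: H.
  case: (lerP v x) => xv; first exact: simple.
  apply/N2 => // i u' v' Hi I' cu'; case/and4P: (I) (I') => ? ? ? ? /and4P [? ? ? ?].
  case: (lerP (x - 1) u') => xu'.
    by rewrite -ext_nz_upper; try lia; apply: E => //; rewrite indec_upper I'.
  have v'x : v' <= x by case: (indec_cut I') => // -[]; lia.
  apply/negP => E'; have [j [ji E1 _]] : exists j, [/\ (j < i)%N, ext_nz g j u v (x - 1) x &
    ext_nz g (i - j.+1) (x - 1) x u' v'] by apply: ext_nz_cut E'; lia.
  have := E j (x - 1) x; rewrite indec_upper Ix lexx ext_nz_upper; try lia.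
  by rewrite E1 => /(_ _ isT cx); lia.
move=> i u v u' v'; rewrite !indec_upper => /andP [I ux] /andP [I' ux'] cu cu'.
by case/and4P: (I) (I') => ? ? ? ? /and4P [? ? ? ?]; rewrite ext_nz_upper; try lia; apply: N3.
Qed.
End Glue.
End Cuts.

(** * Gluing of algebras in terms of their bounds *)

Section Gluing.
Local Open Scope ring_scope.
Implicit Types (L : nakalg) (u v w x : int) (i j l m n : nat) (c : int -> int -> Prop).

Lemma galois_exists A B g : decreasing_bound A B g -> exists f, galois_bound A B g f.
Proof.
move=> [gb gm].
(* f u is the largest v with g v <= u, found by searching down from B; the second disjunct makes the
   search end for every integer u. *)
have ex u : exists j : nat, (g (B - j%:Z) <= u) || (B - j%:Z <= u).
  by exists `|(B - u)%R|%N; apply/orP; right; lia.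
exists (fun u => B - (ex_minn (ex u))%:Z); split=> //.
  move=> u Hu; case: ex_minnP => j _ jm; have := jm `|(B - u)%R|%N.
  have -> : B - `|(B - u)%R|%N%:Z = u by lia.
  by rewrite lexx orbT => /(_ isT); lia.
move=> u v Hu Hv; case: ex_minnP => j Hj jm; apply/idP/idP => [gv|vj].
  have := jm `|(B - v)%R|%N; have -> : B - `|(B - v)%R|%N%:Z = v by lia.
  by rewrite gv => /(_ isT); lia.
have := gm v (B - j%:Z); have := gb (B - j%:Z); lia.
Qed.

Lemma low_decreasing L : decreasing_bound (na_a L - 1) (na_b L) (low L).
Proof.
by split=> [v Hv|v w av vw wb]; [have := low_le L v; have := @low_ge L v; lia | apply: low_mono].
Qed.

Lemma low_admissible L : admissible_bound (na_a L - 1) (low L) (na_b L).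
Proof.
by split=> v Hv; [apply: low_lt; lia | apply: low_lt2; lia].
Qed.

Lemma low_eq L v t : v <= na_b L -> t <= v ->
  (forall l, (na_z L v l || (v - l%:Z < na_a L)) = (v - l%:Z <= t)) -> low L v = t.
Proof.
move=> vb tv H; have := H `|(v - t)%R|%N; have := H `|(v - low L v)%R|%N.
by rewrite !lowP //; have := low_le L v; lia.
Qed.

Lemma na_z_length L v l : na_z L v l -> (0 < l)%N.
Proof. by case: l => // Hz; have [] := na_adm L v; rewrite Hz. Qed.

Lemma na_z_valid L v l : na_z L v l -> valid_path (na_a L) (na_b L) v l.
Proof. by move=> Hz; apply: contraT => /na_canon; rewrite Hz. Qed.

Lemma glue_low_lower L1 L2 L v : is_glue L1 L2 L -> na_a L - 1 <= v <= na_b L1 -> low L v = low L1 v.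
Proof.
move=> [E1 [E2 [E3 E4]]] Hv; have ab2 := na_ab L2; have le1 := low_le L1 v.
apply: low_eq => [||l] //; first by lia.
rewrite -lowP; last by lia.
rewrite E2; case: (ltP (v - l%:Z) (na_a L1)) => al; rewrite ?orbT ?orbF //.
apply/idP/idP => Hz; last first.
  by apply/E4; [rewrite /valid_path; lia | left; exists v, l; rewrite !lexx; do 2!split => //; left].
have /E4 [] := Hz; first by rewrite /valid_path; lia.
  move=> [j' [l' [jv [jl [Hz'|Hz']]]]]; first by apply: na_ideal Hz' => //; rewrite /valid_path; lia.
  by have := na_z_length Hz'; have := na_z_valid Hz'; rewrite /valid_path; lia.
by lia.
Qed.

Lemma glue_low_upper L1 L2 L v : is_glue L1 L2 L -> na_a L2 - 1 <= v <= na_b L2 ->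
  low L2 v = upper_bound (low L) (na_b L1) v.
Proof.
move=> [E1 [E2 [E3 E4]]] Hv; have ab1 := na_ab L1; rewrite /upper_bound.
case: (lerP v (na_b L1)) => vx.
  by have := @low_ge L2 v; have := low_le L2 v; have := @low_lt L2 v; lia.
apply: low_eq => [||l]; [by lia | exact: low_le | ].
rewrite -lowP; last by lia.
case: (ltP (v - l%:Z) (na_a L2)) => al; rewrite ?orbT ?orbF.
  case: (ltP (v - l%:Z) (na_a L)) => al'; rewrite ?orbT ?orbF //.
  by symmetry; apply/E4; [rewrite /valid_path; lia | right; lia].
have -> : v - l%:Z < na_a L = false by lia.
rewrite orbF; apply/idP/idP => Hz.
  by apply/E4; [rewrite /valid_path; lia | left; exists v, l; rewrite !lexx; do 2!split => //; right].
have /E4 [] := Hz; first by rewrite /valid_path; lia.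
  move=> [j' [l' [jv [jl [Hz'|Hz']]]]]; last by apply: na_ideal Hz' => //; rewrite /valid_path; lia.
  by have := na_z_length Hz'; have := na_z_valid Hz'; rewrite /valid_path; lia.
by lia.
Qed.

Lemma glue_low_cut L1 L2 L : is_glue L1 L2 L -> low L (na_b L1 + 1) = na_b L1 - 1.
Proof.
move=> G; have [E1 [E2 [E3 E4]]] := G; have ab1 := na_ab L1; have ab2 := na_ab L2.
have := @glue_low_upper _ _ _ (na_b L1 + 1) G; rewrite /upper_bound ifN; last by lia.
move=> <-; last by lia.
by have := @low_ge L2 (na_b L1 + 1); have := @low_lt2 L2 (na_b L1 + 1); lia.
Qed.

(** The factors restrict the ideal to the two vertex ranges. Paths through x + 1 -> x -> x - 1 lie
    in the ideal by monotonicity of [low], so nothing is lost. *)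
Lemma cut_glue L x : na_a L < x < na_b L -> low L (x + 1) = x - 1 ->
  exists L1 L2, [/\ is_glue L1 L2 L, na_b L1 = x & na_a L2 = x].
Proof.
move=> Hx cut.
have ax : na_a L < x by lia.
have xb : x < na_b L by lia.
pose z (a b j : int) l := valid_path a b j l && na_z L j l.
have canon (a b j : int) l : ~~ valid_path a b j l -> ~~ z a b j l by rewrite /z => /negbTE ->.
have ideal (a b : int) : na_a L <= a -> b <= na_b L ->
    forall (j : int) l (j' : int) l', valid_path a b j' l' ->
    j <= j' -> j' - l'%:Z <= j - l%:Z -> z a b j l -> z a b j' l'.
  move=> Ha Hb j l j' l' V jj jl /andP [V' Hz]; rewrite /z V /=; apply: na_ideal jj jl Hz.
  by move: V; rewrite /valid_path; lia.
have adm (a b j : int) : ~~ z a b j 0%N /\ ~~ z a b j 1%N.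
  by rewrite /z; have [/negbTE -> /negbTE ->] := na_adm L j; rewrite !andbF.
pose L1 := @NakAlg (na_a L) x ax (z (na_a L) x) (canon _ _) (ideal _ _ (lexx _) (ltW xb)) (adm _ _).
pose L2 := @NakAlg x (na_b L) xb (z x (na_b L)) (canon _ _) (ideal _ _ (ltW ax) (lexx _)) (adm _ _).
exists L1, L2; split => //; split => //; split => //; split => // v l V /=.
split=> [Hz|[[j [m [jv [jm [/andP [_ Hz]|/andP [_ Hz]]]]]]|[xv vx]]].
- case: (lerP v x) => vx.
    left; exists v, l; do 2!split => //; left; rewrite /z Hz andbT.
    by move: V; rewrite /valid_path; lia.
  case: (lerP x (v - l%:Z)) => xv; last by right; lia.
  left; exists v, l; do 2!split => //; right; rewrite /z Hz andbT.
  by move: V; rewrite /valid_path; lia.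
- exact: na_ideal Hz.
- exact: na_ideal Hz.
have := @low_mono L (x + 1) v; have := lowP (L := L) (v := v) l; move: V; rewrite /valid_path; lia.
Qed.

Lemma homogeneous_low L l : (2 <= l)%N ->
  (forall v, na_a L - 1 <= v <= na_b L -> low L v = Num.max (na_a L - 1) (v - l%:Z)) -> homogeneous L.
Proof.
move=> l2 H; exists l; split => // j l'; rewrite /valid_path => V.
by have := lowP (L := L) (v := j) l'; have := H j; lia.
Qed.

Lemma comb_no_cut_homogeneous n L c : (1 < n)%N -> comb_nZct n (na_a L - 1) (na_b L) (low L) c ->
  (forall x, na_a L < x < na_b L -> ~ c (x - 1) x) -> homogeneous L.
Proof.
move=> Hn N nocut; have [f H] := galois_exists (low_decreasing L); have ab := na_ab L.
have [||l [l2 Hl]] := no_cut_homogeneous H N Hn (low_admissible L); first by lia.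
  by move=> x Hx; apply: nocut; lia.
exact: homogeneous_low l2 Hl.
Qed.

(** A nonzero Ext into ]B - 1, B] needs a source with top beyond B. With [comb_bottom_simple], both
    factors contain the simple module at a gluing vertex. *)
Lemma comb_top_simple n A B g c : decreasing_bound A B g -> comb_nZct n A B g c ->
  indec A B g (B - 1) B -> c (B - 1) B.
Proof.
move=> dg [N1 _ _] I; apply/N1 => // i u v _ /and4P [? ? ? ?] _; apply/negP => E.
by have [|||| ? ?] := ext_nz_lt dg _ _ _ _ E; lia.
Qed.

Lemma comb_bottom_simple n A B g c : decreasing_bound A B g -> comb_nZct n A B g c ->
  indec A B g A (A + 1) -> c A (A + 1).
Proof.
move=> dg [_ N2 _] I; apply/N2 => // i u v _ /and4P [? ? ? ?] _; apply/negP => E.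
by case/and4P: I => ? ? ? ?; have [|||| ? ?] := ext_nz_lt dg _ _ _ _ E; lia.
Qed.
End Gluing.

(** * Decomposition into homogeneous pieces and reassembly *)

Section Main.
Local Open Scope ring_scope.
Variables (k : fieldType) (n : nat).
Implicit Types (L : nakalg) (LC : seq (nakalg * (rep k -> Prop))).

Lemma homogeneous_pieces L c : (1 < n)%N -> comb_nZct n (na_a L - 1) (na_b L) (low L) c ->
  exists LC, glued (map fst LC) L /\
    forall p, List.In p LC -> homogeneous p.1 /\ nZ_cluster_tilting n p.1 p.2.
Proof.
move=> Hn; have [m] := ubnP `|(na_b L - na_a L)%R|; elim: m L => // m IH L Lm N.
have [f H] := galois_exists (low_decreasing L); have ab := na_ab L.
pose is_cut x := na_a L < x < na_b L /\ c (x - 1) x.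
case: (classic (exists x, is_cut x)) => [[y cuty]|nocut]; last first.
  exists [:: (L, sum_of_itvs L c)]; split; first by split.
  move=> _ [<-|//]; split=> /=; last exact: comb_nZct_exists.
  by apply: comb_no_cut_homogeneous N _ => // x Hx cx; apply: nocut; exists x.
(* Minimality leaves no interior simple module of [c] in the lower factor, so that factor is
   homogeneous and the induction continues with the upper one. *)
have [x [[Hx cx] xmin]] : exists x, is_cut x /\ forall x', x' < x -> ~ is_cut x'.
  have [s] := ubnP `|(y - na_a L)%R|; elim: s y cuty => // s IHs y cuty ys.
  case: (classic (exists y', y' < y /\ is_cut y')) => [[y' [yy cut']]|nos].
    by apply: (IHs y' cut'); case: cut' cuty => ? _ [? _]; lia.
  by exists y; split => // x' Hx' cut'; apply: nos; exists x'.
have cut : low L (x + 1) = x - 1.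
  by apply: (simple_cut H N Hn (low_admissible L)) cx; lia.
have [L1 [L2 [G b1 a2]]] := cut_glue Hx cut; have [E1 [E2 [E3 E4]]] := G.
have dL := low_decreasing L; have strictL := (low_admissible L).1.
have Hx' : na_a L - 1 + 1 < x < na_b L by lia.
have [N1 N2] := comb_nZct_split dL strictL Hx' cut cx N.
have N1' : comb_nZct n (na_a L1 - 1) (na_b L1) (low L1) c.
  rewrite -E2 b1; apply: (comb_nZct_congr _ _ _ N1) => //.
    by have [gb gm] := dL; split=> [v Hv|v w ? ? ?]; [apply: gb; lia | apply: gm; lia].
  by move=> v Hv; apply: (glue_low_lower G); lia.
have N2' : comb_nZct n (na_a L2 - 1) (na_b L2) (low L2) c.
  rewrite -E3 a2; apply: (comb_nZct_congr _ _ _ N2) => //.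
    exact: upper_decreasing dL Hx' cut.
  by move=> v Hv; rewrite (glue_low_upper G) ?b1 //; lia.
have [|LC [GLC HLC]] := IH L2 _ N2'; first by rewrite -E3; lia.
exists ((L1, sum_of_itvs L1 c) :: LC); split.
  by case: LC GLC HLC => [|p LC] GLC HLC //=; exists L2.
move=> _ [<-|/HLC //]; split=> /=; last exact: comb_nZct_exists.
apply: comb_no_cut_homogeneous N1' _ => // x' Hx1 cx'.
by apply: (xmin x'); [lia | split => //; lia].
Qed.

Definition union_itvs LC u v := exists p, List.In p LC /\ u < v /\ p.2 (itv k u v).

(** The union restricts to the given set on each factor: an interval common to two adjacent parts is
    the simple module at the gluing vertex, and both parts contain it. *)
Lemma union_comb LC L : glued (map fst LC) L ->
  (forall p, List.In p LC -> nZ_cluster_tilting n p.1 p.2) ->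
  comb_nZct n (na_a L - 1) (na_b L) (low L) (union_itvs LC) /\
  forall u v, union_itvs LC u v -> indec (na_a L - 1) (na_b L) (low L) u v.
Proof.
elim: LC L => // p LC IH L G HLC.
have CTp := HLC p (or_introl erefl); have Np := nZct_comb CTp.
have Ip u v : u < v -> p.2 (itv k u v) -> indec (na_a p.1 - 1) (na_b p.1) (low p.1) u v.
  by move=> uv Cp; rewrite indec_valid uv (module_itv uv (nct_module CTp.1 Cp)).
case: LC G HLC IH => [|q LC] G HLC IH.
  have [Ea [Eb Ez]] := G.
  have El v : v <= na_b L -> low L v = low p.1 v.
    move=> vb; apply: low_eq; rewrite ?low_le // => l.
    by rewrite -Ez -Ea lowP // Eb.
  have IE u v : indec (na_a L - 1) (na_b L) (low L) u v =
      indec (na_a p.1 - 1) (na_b p.1) (low p.1) u v.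
    by rewrite /indec Ea Eb; case: (lerP v (na_b L)) => vb; rewrite ?andbF // El.
  split; last by move=> u v [_ [[<-|//] [uv Cp]]]; rewrite IE; apply: Ip.
  rewrite -Ea -Eb; apply: comb_nZct_congr (low_decreasing p.1) _ _ Np.
    by move=> v Hv; rewrite El // -Eb; lia.
  move=> u v /and4P [_ _ uv _]; split=> [Cp|[_ [[<-|//] [_ //]]]].
  by exists p; split; [left | ].
have [L' [G' glueL]] := G.
have [|N' I'] := IH L' G'; first by move=> r Hr; apply: HLC; right.
have [E1 [E2 [E3 E4]]] := glueL.
have ab1 := na_ab p.1; have ab2 := na_ab L'.
have dL := low_decreasing L; have strictL := (low_admissible L).1.
have Hx : na_a L - 1 + 1 < na_b p.1 < na_b L by lia.
have cut : low L (na_b p.1 + 1) = na_b p.1 - 1 by apply: glue_low_cut glueL.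
have lowL v : na_a p.1 - 1 <= v <= na_b p.1 -> low p.1 v = low L v.
  by move=> Hv; symmetry; apply: glue_low_lower glueL _; rewrite E2.
have upL v : na_a L' - 1 <= v <= na_b L' -> low L' v = upper_bound (low L) (na_b p.1) v.
  by move=> Hv; apply: (glue_low_upper glueL).
have I1E u v : indec (na_a p.1 - 1) (na_b p.1) (low p.1) u v =
    indec (na_a L - 1) (na_b p.1) (low L) u v.
  by rewrite /indec E2; have := lowL v; lia.
have I2E u v : indec (na_a L' - 1) (na_b L') (low L') u v =
    indec (na_b p.1 - 1) (na_b L) (upper_bound (low L) (na_b p.1)) u v.
  by rewrite /indec E3 -E1; have := upL v; rewrite -E1; lia.
have simple1 : p.2 (itv k (na_b p.1 - 1) (na_b p.1)).
  apply: (comb_top_simple (low_decreasing p.1) Np); rewrite I1E /indec.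
  by have := strictL (na_b p.1); lia.
have simple2 : union_itvs (q :: LC) (na_b p.1 - 1) (na_b p.1).
  have := comb_bottom_simple (low_decreasing L') N'; rewrite I2E -E1 subrK; apply.
  by rewrite /indec /upper_bound !lexx; lia.
have unionE u v : union_itvs (p :: q :: LC) u v <->
    (u < v /\ p.2 (itv k u v)) \/ union_itvs (q :: LC) u v.
  split=> [[r [[<-|Hr] H]]|[H|[r [Hr H]]]]; [by left | by right; exists r | | ].
    by exists p; split => //; left.
  by exists r; split => //; right.
have at_cut u v : indec (na_a p.1 - 1) (na_b p.1) (low p.1) u v ->
    indec (na_a L' - 1) (na_b L') (low L') u v -> u = na_b p.1 - 1 /\ v = na_b p.1.
  by rewrite /indec; lia.
split; last first.
  move=> u v /unionE [[uv Cp]|/I'].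
    by have := Ip u v uv Cp; rewrite I1E (indec_lower Hx cut) => /andP [].
  by rewrite I2E (indec_upper dL strictL Hx cut) => /andP [].
apply: (comb_nZct_glue dL strictL Hx cut).
- by apply/unionE; right.
- have -> : na_a L - 1 = na_a p.1 - 1 by rewrite E2.
  apply: comb_nZct_congr (low_decreasing p.1) lowL _ Np => u v I1; split=> [Cp|].
    by apply/unionE; left; split => //; case/and4P: I1.
  by move/unionE => [[] //|/I' I2]; have [-> ->] := at_cut u v I1 I2.
have -> : na_b L = na_b L' by [].
have -> : na_b p.1 - 1 = na_a L' - 1 by rewrite -E1.
apply: comb_nZct_congr (low_decreasing L') upL _ N' => u v I2; split=> [H|].
  by apply/unionE; right.
by move/unionE => [[uv Cp]|//]; have [-> ->] := at_cut u v (Ip u v uv Cp) I2.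
Qed.

(** By uniqueness [C] and the union contain the same intervals, and both sides are the additive
    closure of these. *)
Lemma nZct_add_of L C LC : nZ_cluster_tilting n L C -> glued (map fst LC) L ->
  (forall p, List.In p LC -> nZ_cluster_tilting n p.1 p.2) ->
  forall X, C X <-> add_of L (fun Y => exists p, List.In p LC /\ p.2 Y) X.
Proof.
move=> CT G HLC X; have [N I] := union_comb G HLC.
have U u v := comb_nZct_unique (low_decreasing L) (nZct_comb CT) N (u := u) (v := v).
split=> [/(nct_itvs CT.1) [mX [Is [HIs [s [p [hs hp sp]]]]]]|[mX [Ys [HYs R]]]].
  split => //; exists [seq itv k p.1 p.2 | p <- Is]; split; last by exists s, p.
  move=> _ /In_mapP [q [/In_mem /HIs [qv [Vq Cq]] ->]].
  have /U [U1 _] : indec (na_a L - 1) (na_b L) (low L) q.1 q.2 by rewrite indec_valid qv.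
  by have [r [Hr [_ Cr]]] := U1 Cq; exists r.
have {}R : retract X (dsum_list Ys) by case: R => s [p [? [? ?]]]; exists s, p.
apply: (nct_retract CT.1 R); apply: (nct_dsum_list CT.1) => Y /HYs [p [Hp CY]].
have /(nct_itvs (HLC p Hp).1) [_ [Is [HIs RY]]] := CY.
apply: (nct_retract CT.1 RY); apply: (nct_dsum_list CT.1).
move=> _ /In_mapP [q [/In_mem /HIs [qv [Vq Cq]] ->]].
have Uq : union_itvs LC q.1 q.2 by exists p.
by apply/(U _ _ (I _ _ Uq)).
Qed.
End Main.

Theorem theorem4p19 (k : fieldType) (n : nat) (hn : (2 <= n)%N) (L : nakalg) :
  ((exists C : rep k -> Prop, nZ_cluster_tilting n L C) <->
   (exists LC : seq (nakalg * (rep k -> Prop)),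
      glued (map fst LC) L /\
      forall p, List.In p LC -> homogeneous p.1 /\ nZ_cluster_tilting n p.1 p.2))
  /\
  (forall (C : rep k -> Prop) (LC : seq (nakalg * (rep k -> Prop))),
      nZ_cluster_tilting n L C ->
      glued (map fst LC) L ->
      (forall p, List.In p LC -> homogeneous p.1 /\ nZ_cluster_tilting n p.1 p.2) ->
      forall X : rep k,
        C X <-> add_of L (fun Y => exists p, List.In p LC /\ p.2 Y) X).
Proof.
split; last by move=> C LC CT G HLC; apply: nZct_add_of CT G _ => p /HLC [].
split=> [[C CT]|[LC [G HLC]]]; first exact: homogeneous_pieces hn (nZct_comb CT).
have [N _] := union_comb G (fun p Hp => (HLC p Hp).2).
by exists (sum_of_itvs L (union_itvs LC)); apply: comb_nZct_exists.
Qed.
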